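(* Let $M(\phi,\xi,\eta,g_M)$ be a cosymplectic manifold, $(N,g_N)$ a Riemannian manifold, and $F:M\to N$ a slant Riemannian submersion such that $\xi$ is vertical. Then $F$ is totally geodesic if and only if $$g_M(\mathcal H\nabla_U\omega\psi V,X)=g_M(\mathcal T_U\omega V,\mathcal BX)+g_M(\mathcal H\nabla_U\omega V,\mathcal CX)$$ and $$g_M(\mathcal H\nabla_Z\omega\psi U,X)=g_M(\mathcal A_Z\omega U,\mathcal BX)+g_M(\mathcal H\nabla_Z\omega U,\mathcal CX)$$ for all $U,V\in\Gamma(\ker F_* )$ and $X,Z\in\Gamma((\ker F_* )^\perp)$.
   Context: An almost contact metric structure $(\phi,\xi,\eta,g_M)$ on an odd-dimensional manifold $M$ consists of a $(1,1)$-tensor $\phi$, a vector field $\xi$, a $1$-form $\eta$ and a Riemannian metric $g_M$ with $\phi^2=-I+\eta\otimes\xi$, $\phi\xi=0$, $\eta\circ\phi=0$, $\eta(\xi)=1$, $g_M(\phi X,\phi Y)=g_M(X,Y)-\eta(X)\eta(Y)$, $\eta(X)=g_M(X,\xi)$. It is cosymplectic if it is normal and $\eta$ and $\Phi(X,Y)=g_M(X,\phi Y)$ are closed; the structure equation is $\nabla\phi=0$, and then $\nabla\xi=0$ ($\nabla$ the Levi-Civita connection of $g_M$). A Riemannian submersion $F:(M,g_M)\to(N,g_N)$ is a smooth surjective map of maximal rank such that $F_*$ preserves the lengths of horizontal vectors. Vertical means in $\ker F_*$, horizontal means in $(\ker F_* )^\perp$; $\mathcal V,\mathcal H$ are the corresponding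 orthogonal projections. O'Neill's tensors are $\mathcal T_EG=\mathcal H\nabla_{\mathcal VE}\mathcal VG+\mathcal V\nabla_{\mathcal VE}\mathcal HG$ and $\mathcal A_EG=\mathcal V\nabla_{\mathcal HE}\mathcal HG+\mathcal H\nabla_{\mathcal HE}\mathcal VG$. For vertical $U$: $\phi U=\psi U+\omega U$ with $\psi U$ vertical, $\omega U$ horizontal. For horizontal $X$: $\phi X=\mathcal BX+\mathcal CX$ with $\mathcal BX$ vertical, $\mathcal CX$ horizontal. $F$ is slant if for every nonzero vertical vector $X$ (not a multiple of $\xi$) the angle between $\phi X$ and $\ker F_*$ is a constant $\theta$ (the slant angle) independent of the point and of $X$. $F$ is totally geodesic if its second fundamental form $(\nabla F_* )(X,Y)=\nabla^F_XF_*Y-F_*(\nabla_XY)$ vanishes for all $X,Y\in\Gamma(TM)$, where $\nabla^F$ is the pullback connection.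
   Formalization: The slant angle θ is assumed nonzero: for θ = 0 (invariant submersions) ω = 0, both equations read 0 = 0, and the claim fails, since such a submersion need not have totally geodesic fibres. *)

(* Defs.v *)
From HB Require Import structures.
From mathcomp Require Import all_boot all_order all_algebra.
From mathcomp Require Import all_classical all_reals all_analysis.
Set Implicit Arguments.
Unset Strict Implicit.
Unset Printing Implicit Defensive.
Import Order.TTheory GRing.Theory Num.Theory.
Import numFieldNormedType.Exports.
Local Open Scope classical_set_scope.
Local Open Scope ring_scope.

Section Manifolds.
Context {R : realType}.

(* C^oo near x: differentiability of all iterated directional derivatives also
   gives their continuity. *)
Definition smooth_at n (f : 'rV[R]_n -> R) (x : 'rV[R]_n) : Prop :=
  \forall y \near x, forall s : seq 'rV[R]_n,
    differentiable (foldr (fun v (g : 'rV[R]_n -> R) => 'D_v g) f s) y.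

(* A partial homeomorphism from chart_dom onto an open subset of R^n; both
   functions are total, with irrelevant values outside of these sets. *)
Record chart n (T : topologicalType) := Chart {
  chart_dom : set T;
  chart_fun :> T -> 'rV[R]_n;
  chart_inv : 'rV[R]_n -> T;
  chart_dom_open : open chart_dom;
  chart_img_open : open (chart_fun @` chart_dom);
  chart_funK : forall p, chart_dom p -> chart_inv (chart_fun p) = p;
  chart_fun_cts : forall p, chart_dom p -> {for p, continuous chart_fun};
  chart_inv_cts : forall p, chart_dom p ->
    {for chart_fun p, continuous chart_inv}
}.

Record manifold n := Manifold {
  mcarrier :> topologicalType;
  atlas : set (chart n mcarrier);
  mhausdorff : hausdorff_space mcarrier;
  msecond_countable : @second_countable mcarrier;
  atlas_cover : forall p, exists2 c, atlas c & chart_dom c p;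
  atlas_compat : forall c d, atlas c -> atlas d ->
    forall p, chart_dom c p -> chart_dom d p ->
    forall j, smooth_at (fun x => d (chart_inv c x) ord0 j) (c p)
}.

Definition smooth_fun_at n (M : manifold n) (p : M) (f : M -> R) : Prop :=
  forall c, atlas c -> chart_dom c p -> smooth_at (f \o chart_inv c) (c p).

(* Tangent vectors are directional derivative operators on functions smooth
   near the base point; so that an operator is determined by its action on
   these, it is required to vanish on all other functions. *)
Definition vec n (M : manifold n) := (M -> R) -> R^o.

Definition on_smooth n (M : manifold n) (p : M) (D : vec M) : vec M :=
  fun f => if `[< smooth_fun_at p f >] then D f else 0.

Definition tangent n (M : manifold n) (p : M) : set (vec M) :=
  [set D | exists c, [/\ atlas c, chart_dom c p &
    exists v, D = on_smooth p (fun f => 'D_v (f \o chart_inv c) (c p))]].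

Definition linear_on n (M : manifold n) (S : set (vec M)) (W : lmodType R)
    (L : vec M -> W) : Prop :=
  forall a u v, S u -> S v -> L (a *: u + v) = a *: L u + L v.

Definition smooth_map m n (M : manifold m) (N : manifold n) (F : M -> N) :=
  continuous F /\
  forall p f, smooth_fun_at (F p) f -> smooth_fun_at p (f \o F).

Definition differential m n (M : manifold m) (N : manifold n) (F : M -> N)
    (p : M) (v : vec M) : vec N :=
  on_smooth (F p) (fun f => v (f \o F)).

(* Sections of F^* TN that are defined and smooth near p; values elsewhere are
   irrelevant. *)
Definition field_along_at m n (M : manifold m) (N : manifold n) (F : M -> N)
    (p : M) (Y : M -> vec N) : Prop :=
  (\forall q \near p, tangent (F q) (Y q)) /\
  forall f, smooth_fun_at (F p) f -> smooth_fun_at p (fun q => Y q f).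

Definition field_at m (M : manifold m) := field_along_at (@idfun M).

Definition vector_field m (M : manifold m) (X : M -> vec M) : Prop :=
  forall p, field_at p X.

Definition bracket m (M : manifold m) (X Y : M -> vec M) : M -> vec M :=
  fun p => on_smooth p
    (fun f => X p (fun q => Y q f) - Y p (fun q => X q f)).

(* D p v Y is the derivative at p of Y in the direction v; it is applied to
   fields defined near p only. *)
Record connection_along m n (M : manifold m) (N : manifold n) (F : M -> N)
    (D : M -> vec M -> (M -> vec N) -> vec N) : Prop := {
  conn_tangent : forall p v Y, tangent p v -> field_along_at F p Y ->
    tangent (F p) (D p v Y);
  conn_linear : forall p Y, field_along_at F p Y ->
    linear_on (tangent p) (fun v => D p v Y);
  conn_additive : forall p v Y Z, tangent p v ->
    field_along_at F p Y -> field_along_at F p Z ->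
    D p v (fun q => Y q + Z q) = D p v Y + D p v Z;
  conn_leibniz : forall p v (f : M -> R) Y, tangent p v ->
    smooth_fun_at p f -> field_along_at F p Y ->
    D p v (fun q => f q *: Y q) = v f *: Y p + f p *: D p v Y;
  conn_smooth : forall p X Y, field_at p X -> field_along_at F p Y ->
    field_along_at F p (fun q => D q (X q) Y)
}.

Record pullback_connection m n (M : manifold m) (N : manifold n) (F : M -> N)
    (nablaN : N -> vec N -> (N -> vec N) -> vec N)
    (nablaF : M -> vec M -> (M -> vec N) -> vec N) : Prop := {
  pullback_conn : connection_along F nablaF;
  pullback_comp : forall p v Y, tangent p v -> field_at (F p) Y ->
    nablaF p v (Y \o F) = nablaN (F p) (differential F p v) Y
}.

Record riemannian_metric m (M : manifold m) (g : M -> vec M -> vec M -> R) :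
    Prop := {
  metric_linear : forall p w, tangent p w ->
    linear_on (W := R^o) (tangent p) (fun v => g p v w);
  metric_sym : forall p v w, tangent p v -> tangent p w -> g p v w = g p w v;
  metric_pos : forall p v, tangent p v -> v <> 0 -> 0 < g p v v;
  metric_smooth : forall p X Y, field_at p X -> field_at p Y ->
    smooth_fun_at p (fun q => g q (X q) (Y q))
}.

Record levi_civita m (M : manifold m) (g : M -> vec M -> vec M -> R)
    (nabla : M -> vec M -> (M -> vec M) -> vec M) : Prop := {
  lc_conn : connection_along (@idfun M) nabla;
  lc_torsion_free : forall p X Y, field_at p X -> field_at p Y ->
    nabla p (X p) Y - nabla p (Y p) X = bracket X Y p;
  lc_metric : forall p v Y Z, tangent p v -> field_at p Y -> field_at p Z ->
    v (fun q => g q (Y q) (Z q)) = g p (nabla p v Y) (Z p) + g p (Y p) (nabla p v Z)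
}.

End Manifolds.

Section AlmostContact.
Context {R : realType} {m : nat} {M : @manifold R m}.
Variables (phi : M -> vec M -> vec M) (xi : M -> vec M) (eta : M -> vec M -> R)
  (g : M -> vec M -> vec M -> R).

Record almost_contact_metric : Prop := {
  ac_odd : odd m;
  ac_metric : riemannian_metric g;
  ac_phi_tangent : forall p v, tangent p v -> tangent p (phi p v);
  ac_phi_linear : forall p, linear_on (tangent p) (phi p);
  ac_phi_smooth : forall p X, field_at p X -> field_at p (fun q => phi q (X q));
  ac_xi : vector_field xi;
  ac_eta_linear : forall p, linear_on (W := R^o) (tangent p) (eta p);
  ac_eta_smooth : forall p X, field_at p X ->
    smooth_fun_at p (fun q => eta q (X q));
  ac_phi2 : forall p v, tangent p v -> phi p (phi p v) = - v + eta p v *: xi p;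
  ac_phi_xi : forall p, phi p (xi p) = 0;
  ac_eta_phi : forall p v, tangent p v -> eta p (phi p v) = 0;
  ac_eta_xi : forall p, eta p (xi p) = 1;
  ac_compat : forall p v w, tangent p v -> tangent p w ->
    g p (phi p v) (phi p w) = g p v w - eta p v * eta p w;
  ac_eta_g : forall p v, tangent p v -> eta p v = g p v (xi p)
}.

(* Exterior derivatives carry no factor 1/2 or 1/3; thus d_eta below is what is
   written 2 d eta when d eta (X, Y) = (X eta(Y) - Y eta(X) - eta [X, Y]) / 2. *)
Definition d_eta (X Y : M -> vec M) (p : M) : R :=
  X p (fun q => eta q (Y q)) - Y p (fun q => eta q (X q))
  - eta p (bracket X Y p).

Definition Phi (p : M) (v w : vec M) : R := g p v (phi p w).

Definition d_Phi (X Y Z : M -> vec M) (p : M) : R :=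
  X p (fun q => Phi q (Y q) (Z q)) + Y p (fun q => Phi q (Z q) (X q))
  + Z p (fun q => Phi q (X q) (Y q))
  - Phi p (bracket X Y p) (Z p) - Phi p (bracket Y Z p) (X p)
  - Phi p (bracket Z X p) (Y p).

Definition nijenhuis (X Y : M -> vec M) (p : M) : vec M :=
  let phiX := fun q => phi q (X q) in
  let phiY := fun q => phi q (Y q) in
  phi p (phi p (bracket X Y p)) + bracket phiX phiY p
  - phi p (bracket phiX Y p) - phi p (bracket X phiY p).

Record cosymplectic : Prop := {
  cos_acm : almost_contact_metric;
  cos_normal : forall p X Y, field_at p X -> field_at p Y ->
    nijenhuis X Y p + d_eta X Y p *: xi p = 0;
  cos_eta_closed : forall p X Y, field_at p X -> field_at p Y ->
    d_eta X Y p = 0;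
  cos_Phi_closed : forall p X Y Z,
    field_at p X -> field_at p Y -> field_at p Z -> d_Phi X Y Z p = 0
}.

End AlmostContact.

Section Submersion.
Context {R : realType} {m n : nat} {M : @manifold R m} {N : @manifold R n}.
Variables (gM : M -> vec M -> vec M -> R) (gN : N -> vec N -> vec N -> R)
  (F : M -> N).

Definition vertical (p : M) : set (vec M) :=
  [set v | tangent p v /\ differential F p v = 0].

Definition horizontal (p : M) : set (vec M) :=
  [set v | tangent p v /\ forall u, vertical p u -> gM p v u = 0].

Record riemannian_submersion : Prop := {
  rs_smooth : smooth_map F;
  rs_surj : forall y, exists p, F p = y;
  rs_max_rank : forall p w, tangent (F p) w ->
    exists2 v, tangent p v & differential F p v = w;
  rs_length : forall p v, horizontal p v ->
    gN (F p) (differential F p v) (differential F p v) = gM p v v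
}.

(* The vertical component of v: the u in ker F_* with v - u orthogonal to
   ker F_*. *)
Definition Vproj (p : M) (v : vec M) : vec M :=
  xget 0 [set u | vertical p u /\ horizontal p (v - u)].

Definition Hproj (p : M) (v : vec M) : vec M := v - Vproj p v.

Definition vertical_field (U : M -> vec M) : Prop :=
  vector_field U /\ forall p, vertical p (U p).

Definition horizontal_field (X : M -> vec M) : Prop :=
  vector_field X /\ forall p, horizontal p (X p).

Section ONeill.
Variable nablaM : M -> vec M -> (M -> vec M) -> vec M.

Definition oneill_T (E G : M -> vec M) (p : M) : vec M :=
  Hproj p (nablaM p (Vproj p (E p)) (fun q => Vproj q (G q)))
  + Vproj p (nablaM p (Vproj p (E p)) (fun q => Hproj q (G q))).

Definition oneill_A (E G : M -> vec M) (p : M) : vec M :=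
  Vproj p (nablaM p (Hproj p (E p)) (fun q => Hproj q (G q)))
  + Hproj p (nablaM p (Hproj p (E p)) (fun q => Vproj q (G q))).

Definition second_fundamental_form
    (nablaF : M -> vec M -> (M -> vec N) -> vec N)
    (X Y : M -> vec M) (p : M) : vec N :=
  nablaF p (X p) (fun q => differential F q (Y q))
  - differential F p (nablaM p (X p) Y).

Definition totally_geodesic
    (nablaF : M -> vec M -> (M -> vec N) -> vec N) : Prop :=
  forall X Y, vector_field X -> vector_field Y ->
    forall p, second_fundamental_form nablaF X Y p = 0.

End ONeill.

Section Slant.
Variables (phi : M -> vec M -> vec M) (xi : M -> vec M).

(* psi, omega are meant on vertical vectors and B, C on horizontal ones. *)
Definition psi (p : M) (u : vec M) : vec M := Vproj p (phi p u).
Definition omega (p : M) (u : vec M) : vec M := Hproj p (phi p u).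
Definition Bpart (p : M) (x : vec M) : vec M := Vproj p (phi p x).
Definition Cpart (p : M) (x : vec M) : vec M := Hproj p (phi p x).

Definition gnorm (p : M) (v : vec M) : R := Num.sqrt (gM p v v).

(* The angle in [0, pi / 2] between w <> 0 and its orthogonal projection onto
   ker F_*. *)
Definition angle_to_vertical (p : M) (w : vec M) : R :=
  acos (gnorm p (Vproj p w) / gnorm p w).

(* theta = 0 is the invariant case, where phi preserves ker F_* and omega
   vanishes. If ker F_* is spanned by xi, every theta satisfies this. *)
Definition slant (theta : R) : Prop :=
  forall p u, vertical p u -> (forall a, u <> a *: xi p) ->
    angle_to_vertical p (phi p u) = theta.

End Slant.

End Submersion.

(* Main.v *)
(* Since phi is parallel and xi is vertical and parallel, expanding
   g(nabla_E V, X) = g(phi (nabla_E V), phi X) for V vertical and X horizontal,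
   with phi = psi + omega on vertical vectors and psi^2 V = -c (V - eta(V) xi),
   c = cos^2 theta, gives
     (1 - c) g(nabla_E V, X) = - g(H nabla_E (omega (psi V)), X)
       + g(V nabla_E (omega V), B X) + g(H nabla_E (omega V), C X).
   As c <> 1, the two equations say that H nabla_U V = 0 and H nabla_Z U = 0.
   These are the (vertical, vertical) and (horizontal, vertical) parts of the
   second fundamental form, up to F_*; the latter is symmetric, because the
   pullback connection has no torsion, and its (horizontal, horizontal) part
   always vanishes, because that connection is metric and F_* is isometric on
   horizontal vectors. *)
Require Import Defs.
From mathcomp Require Import all_boot all_order all_algebra.
From mathcomp Require Import all_classical all_reals all_analysis.
From mathcomp Require Import ring lra.
Set Implicit Arguments.
Unset Strict Implicit.
Unset Printing Implicit Defensive.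
Import Order.TTheory GRing.Theory Num.Theory.
Import numFieldNormedType.Exports.
Local Open Scope classical_set_scope.
Local Open Scope ring_scope.

(** * Smooth functions on R^n *)

(** That [phi] and [xi] are parallel is not part of [cosymplectic]; it is derived from normality and
    the two closed forms, through linear relations among the components of nabla phi and nabla eta.
    Likewise [nablaF] is only known to be a connection along [F] that satisfies [pullback_comp], so
    its lack of torsion and its compatibility with the metric are computed in coordinate frames
    pulled back from the target. Such frames exist only near a point, while a connection takes
    functions defined everywhere; hence the need for locality. All fields involved must be smooth,
    in particular vertical and horizontal components: [Vproj] is defined by choice, so existence and
    smoothness come from a matrix formula in charts. Test fields on the whole manifold are always
    built from given ones by projection or differentiation, so no vector is ever extended to a
    global field. As for c, the slant condition says nothing about multiples of [xi], but on these
    the formula for psi^2 holds with both sides zero; and c <> 1 comes from theta <> 0, because acos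
    1 = 0. *)

Section SmoothFunctions.
Context {R : realType}.

(** The first-order expansion of [f] at [x] is also one for [g], since the two agree near [x];
    uniqueness of the differential then identifies ['d g x] with ['d f x]. *)
Lemma near_eq_differentiable (V W : normedModType R) (f g : V -> W) (x : V) :
  (\near x, f x = g x) -> differentiable f x -> differentiable g x.
Proof.
move=> fg /diff_locallyP[dfc dfE].
have gE : g \o shift x = cst (g x) + 'd f x +o_ (0 : V) id.
  apply/eqaddoP => e e0; have := dfE; move/eqaddoP => /(_ e e0) H.
  have fg0 : \forall h \near (0 : V), f (h + x) = g (h + x).
    by move: fg; rewrite (near_shift 0)/= subr0.
  apply: filterS2 H fg0 => h; rewrite /= !fctE /= (nbhs_singleton fg).
  by move=> + E; rewrite E.
by apply/diff_locallyP; rewrite (diff_unique dfc gE).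
Qed.

(** With the set fixed once, closure under derivatives can be proved without shrinking a
    neighbourhood at each order. *)
Definition smooth_on n (U : set 'rV[R]_n) (f : 'rV[R]_n -> R) :=
  forall s y, U y ->
    differentiable (foldr (fun v (g : 'rV[R]_n -> R) => 'D_v g) f s) y.

Lemma smooth_atP n (f : 'rV[R]_n -> R) x :
  smooth_at f x <-> exists U, [/\ open U, U x & smooth_on U f].
Proof.
split=> [|[U [oU Ux fU]]]; last first.
  by near=> y => s; apply: fU; near: y; exact: open_nbhs_nbhs.
rewrite /smooth_at /prop_near1 nbhsE => -[U [oU Ux] UP].
by exists U; split => // s y Uy; exact: UP.
Unshelve. all: by end_near. Qed.

Lemma smooth_on_derive n (U : set 'rV[R]_n) f v :
  smooth_on U f -> smooth_on U ('D_v f).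
Proof. by move=> fU s y Uy; have := fU (rcons s v) y Uy; rewrite foldr_rcons. Qed.

Lemma smooth_on_differentiable n (U : set 'rV[R]_n) f y :
  smooth_on U f -> U y -> differentiable f y.
Proof. by move=> fU; exact: (fU [::]). Qed.

Lemma row_decomp n (h : 'I_n -> R) :
  \row_j h j = \sum_j h j *: delta_mx 0 j :> 'rV[R]_n.
Proof. by rewrite [LHS]row_sum_delta; apply: eq_bigr => j _; rewrite mxE. Qed.

Lemma differentiable_row k n (h : 'I_n -> 'rV[R]_k -> R) y :
  (forall j, differentiable (h j) y) ->
  differentiable (fun x => \row_j h j x) y.
Proof.
move=> dh; have -> : (fun x => \row_j h j x) =
    \sum_j (fun x => h j x *: (delta_mx 0 j : 'rV[R]_n)).
  by apply/funext => x; rewrite row_decomp fct_sumE.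
by apply: differentiable_sum => j; exact: differentiableZl.
Qed.

Lemma derive_linear n (f : 'rV[R]_n -> R) y (a : 'I_n -> R) :
  differentiable f y ->
  'D_(\row_j a j) f y = \sum_j a j * 'D_(delta_mx 0 j) f y.
Proof.
move=> df; rewrite deriveE // row_decomp linear_sum; apply: eq_bigr => j _.
by rewrite linearZ deriveE.
Qed.

Lemma derive_comp_row k n (h : 'I_n -> 'rV[R]_k -> R) (f : 'rV[R]_n -> R) y v :
  (forall j, differentiable (h j) y) -> differentiable f (\row_j h j y) ->
  'D_v (fun x => f (\row_j h j x)) y =
  \sum_j 'D_v (h j) y * 'D_(delta_mx 0 j) f (\row_j h j y).
Proof.
move=> dh df; pose H x := \row_j h j x; have dH := differentiable_row dh.
rewrite -/(f \o H) deriveE; last exact: differentiable_comp.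
rewrite diff_comp //= -derive_linear // deriveE //; congr ('d _ _ _).
rewrite -deriveE // derive_mx; last exact: diff_derivable.
apply/rowP => j; rewrite [LHS]mxE [RHS]mxE.
suff -> : (fun t => H t 0 j) = h j by [].
by apply/funext => t; rewrite mxE.
Qed.

(* Smoothness is coinductive in nature: a class of functions that are
   differentiable on U is made of smooth functions as soon as it is closed under
   directional derivatives. *)
Inductive smooth_class n (U : set 'rV[R]_n) : ('rV[R]_n -> R) -> Prop :=
| SmoothBase f : smooth_on U f -> smooth_class U f
| SmoothCst a : smooth_class U (fun=> a)
| SmoothEq f g : (forall x, U x -> f x = g x) ->
    smooth_class U f -> smooth_class U g
| SmoothAdd f g : smooth_class U f -> smooth_class U g ->
    smooth_class U (fun x => f x + g x)
| SmoothMul f g : smooth_class U f -> smooth_class U g ->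
    smooth_class U (fun x => f x * g x)
| SmoothInv f : (forall x, U x -> f x != 0) -> smooth_class U f ->
    smooth_class U (fun x => (f x)^-1)
| SmoothComp k (W : set 'rV[R]_k) f (h : 'I_k -> 'rV[R]_n -> R) :
    smooth_on W f -> (forall j, smooth_on U (h j)) ->
    (forall x, U x -> W (\row_j h j x)) ->
    smooth_class U (fun x => f (\row_j h j x)).

Lemma smooth_class_differentiable n (U : set 'rV[R]_n) f y :
  open U -> smooth_class U f -> U y -> differentiable f y.
Proof.
move=> oU; elim=> {f} [f fU|a|f g fg _ IH|f g _ IHf _ IHg|f g _ IHf _ IHg|
                       f f0 _ IH|k W f h fW hU UW] Uy.
- exact: smooth_on_differentiable fU Uy.
- exact: differentiable_cst.
- apply: near_eq_differentiable (IH Uy); near=> x; apply: fg; near: x.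
  exact: open_nbhs_nbhs.
- exact: differentiableD (IHf Uy) (IHg Uy).
- exact: differentiableM (IHf Uy) (IHg Uy).
- exact: differentiableV (IH Uy) (f0 _ Uy).
- apply: (@differentiable_comp _ _ _ _ (fun x => \row_j h j x)).
    by apply: differentiable_row => j; exact: smooth_on_differentiable Uy.
  by apply: smooth_on_differentiable fW _; exact: UW.
Unshelve. all: by end_near. Qed.

Lemma smooth_class_sum n (U : set 'rV[R]_n) k (f : 'I_k -> 'rV[R]_n -> R) :
  (forall j, smooth_class U (f j)) -> smooth_class U (fun x => \sum_j f j x).
Proof.
elim: k f => [|k IH] f fU.
  by apply: (SmoothEq _ (SmoothCst U 0)) => x _; rewrite big_ord0.
apply: (@SmoothEq _ _ (fun x => f ord0 x + \sum_j f (lift ord0 j) x)).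
  by move=> x _; rewrite big_ord_recl.
by apply: SmoothAdd => //; apply: IH.
Qed.

(** Each constructor is stable under the corresponding rule of calculus. [SmoothComp] keeps [f] and
    the components of [h] in [smooth_on], so that the chain rule yields a sum of products of base
    functions with compositions of the same shape. [SmoothEq] is needed because these rules hold on
    [U] only. *)
Lemma smooth_class_derive n (U : set 'rV[R]_n) f v :
  open U -> smooth_class U f -> smooth_class U ('D_v f).
Proof.
move=> oU; elim=> {f} [f fU|a|f g fg fU IH|f g fU IHf gU IHg|f g fU IHf gU IHg|
                       f f0 fU IH|k W f h fW hU UW].
- by apply: SmoothBase; exact: smooth_on_derive.
- by apply: SmoothEq (SmoothCst U 0) => x _; rewrite derive_cst.
- apply: SmoothEq IH => x Ux; apply: near_eq_derive.
  by near=> y; apply: fg; near: y; exact: open_nbhs_nbhs.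
- apply: SmoothEq (SmoothAdd IHf IHg) => x Ux; rewrite -deriveD //.
  + exact: diff_derivable (smooth_class_differentiable oU fU Ux).
  + exact: diff_derivable (smooth_class_differentiable oU gU Ux).
- apply: SmoothEq (SmoothAdd (SmoothMul fU IHg) (SmoothMul gU IHf)) => x Ux.
  rewrite -[RHS]/('D_v (f * g) x) deriveM //.
  + exact: diff_derivable (smooth_class_differentiable oU fU Ux).
  + exact: diff_derivable (smooth_class_differentiable oU gU Ux).
- have i := SmoothInv f0 fU.
  apply: SmoothEq (SmoothMul (SmoothCst U (-1)) (SmoothMul (SmoothMul i i) IH)).
  move=> x Ux; rewrite deriveV ?f0 //.
    by rewrite /GRing.scale /= expr2 invfM mulN1r mulNr.
  exact: diff_derivable (smooth_class_differentiable oU fU Ux).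
- apply: (@SmoothEq _ _ (fun x =>
      \sum_j 'D_v (h j) x * 'D_(delta_mx 0 j) f (\row_j h j x))).
    move=> x Ux; rewrite derive_comp_row // => [j|].
      exact: smooth_on_differentiable Ux.
    by apply: smooth_on_differentiable fW _; exact: UW.
  apply: smooth_class_sum => j; apply: SmoothMul.
    by apply: SmoothBase; exact: smooth_on_derive.
  by exact: (SmoothComp (smooth_on_derive _ fW) hU UW).
Unshelve. all: by end_near. Qed.

Lemma smooth_class_on n (U : set 'rV[R]_n) f :
  open U -> smooth_class U f -> smooth_on U f.
Proof.
move=> oU fU s y; apply: smooth_class_differentiable => //.
by elim: s => //= v s; exact: smooth_class_derive.
Qed.

Lemma smooth_at_near n (f : 'rV[R]_n -> R) x :
  smooth_at f x -> \forall y \near x, smooth_at f y.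
Proof.
move=> /smooth_atP[U [oU Ux fU]]; near=> y; apply/smooth_atP; exists U.
by split=> //; near: y; exact: open_nbhs_nbhs.
Unshelve. all: by end_near. Qed.

Lemma smooth_at_differentiable n (f : 'rV[R]_n -> R) x :
  smooth_at f x -> differentiable f x.
Proof. by move=> /smooth_atP[U [_ Ux fU]]; exact: smooth_on_differentiable Ux. Qed.

Lemma smooth_at_derive n (f : 'rV[R]_n -> R) x v :
  smooth_at f x -> smooth_at ('D_v f) x.
Proof.
move=> /smooth_atP[U [oU Ux fU]]; apply/smooth_atP; exists U.
by split=> //; exact: smooth_on_derive.
Qed.

Lemma smooth_on_sub n (U W : set 'rV[R]_n) f :
  U `<=` W -> smooth_on W f -> smooth_on U f.
Proof. by move=> UW fW s y Uy; apply: fW; exact: UW. Qed.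

Lemma smooth_at_ext n (f g : 'rV[R]_n -> R) x :
  (\near x, f x = g x) -> smooth_at f x -> smooth_at g x.
Proof.
rewrite /prop_near1 nbhsE => -[W [oW Wx] fg] /smooth_atP[U [oU Ux fU]].
apply/smooth_atP; exists (U `&` W); split=> //; first exact: openI.
apply: smooth_class_on; first exact: openI.
apply: (@SmoothEq _ _ f) => [y [_ /fg]//|].
by apply: SmoothBase; apply: smooth_on_sub fU => y [].
Qed.

Lemma smooth_at_cst n (a : R) (x : 'rV[R]_n) : smooth_at (fun=> a) x.
Proof.
apply/smooth_atP; exists setT; split=> //; first exact: openT.
by apply: smooth_class_on; [exact: openT|exact: SmoothCst].
Qed.

Lemma smooth_atD n (f g : 'rV[R]_n -> R) x :
  smooth_at f x -> smooth_at g x -> smooth_at (fun y => f y + g y) x.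
Proof.
move=> /smooth_atP[U [oU Ux fU]] /smooth_atP[W [oW Wx gW]].
apply/smooth_atP; exists (U `&` W); split=> //; first exact: openI.
apply: smooth_class_on; first exact: openI.
by apply: SmoothAdd; apply: SmoothBase;
  [apply: smooth_on_sub fU|apply: smooth_on_sub gW] => y [].
Qed.

Lemma smooth_atM n (f g : 'rV[R]_n -> R) x :
  smooth_at f x -> smooth_at g x -> smooth_at (fun y => f y * g y) x.
Proof.
move=> /smooth_atP[U [oU Ux fU]] /smooth_atP[W [oW Wx gW]].
apply/smooth_atP; exists (U `&` W); split=> //; first exact: openI.
apply: smooth_class_on; first exact: openI.
by apply: SmoothMul; apply: SmoothBase;
  [apply: smooth_on_sub fU|apply: smooth_on_sub gW] => y [].
Qed.

Lemma smooth_atV n (f : 'rV[R]_n -> R) x :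
  f x != 0 -> smooth_at f x -> smooth_at (fun y => (f y)^-1) x.
Proof.
move=> fx0 sf; have cf : {for x, continuous f}.
  exact: differentiable_continuous (smooth_at_differentiable sf).
have : \forall y \near x, f y != 0.
  by apply: (@cvgr_neq0 _ R^o _ (nbhs x) _ f (f x) _ fx0).
move: sf => /smooth_atP[U [oU Ux fU]]; rewrite /prop_near1 nbhsE => -[W [oW Wx f0]].
apply/smooth_atP; exists (U `&` W); split=> //; first exact: openI.
apply: smooth_class_on; first exact: openI.
apply: SmoothInv => [y [_ /f0]//|].
by apply: SmoothBase; apply: smooth_on_sub fU => y [].
Qed.

Lemma smooth_at_comp k n (f : 'rV[R]_n -> R) (h : 'rV[R]_k -> 'rV[R]_n) x :
  smooth_at f (h x) -> (forall j, smooth_at (fun y => h y 0 j) x) ->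
  smooth_at (f \o h) x.
Proof.
move=> /smooth_atP[W [oW Whx fW]] hx.
have hE y : h y = \row_j h y 0 j by apply/rowP => j; rewrite mxE.
have ch : {for x, continuous h}.
  have -> : h = (fun y => \row_j h y 0 j) by apply/funext => y; exact: hE.
  apply: differentiable_continuous; apply: differentiable_row => j.
  exact: smooth_at_differentiable.
have [U hU] := choice (fun j => (smooth_atP _ _).1 (hx j)).
have : nbhs x ((h @^-1` W) `&` [set y | forall j, U j y]).
  have nU : \forall y \near x, forall j, U j y.
    apply: (@filter_forall _ _ U (nbhs x)) => j; have [oU Ux _] := hU j.
    exact: open_nbhs_nbhs.
  have nW := ch W (open_nbhs_nbhs (conj oW Whx)).
  exact: (@filterI _ (nbhs x) _ _ _ nW nU).
rewrite nbhsE => -[Q [oQ Qx QP]].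
apply/smooth_atP; exists Q; split=> //; apply: smooth_class_on => //.
apply: (@SmoothEq _ _ (fun y => f (\row_j h y 0 j))) => [y _|].
  by rewrite /= -hE.
apply: (SmoothComp fW) => [j|y /QP[hy _]]; last by rewrite -hE.
by have [_ _] := hU j; apply: smooth_on_sub => y /QP[_]; exact.
Qed.

End SmoothFunctions.

(** * Smooth functions and tangent vectors on manifolds *)

Section SmoothOnManifolds.
Context {R : realType} {m : nat} {M : @manifold R m}.
Implicit Types (c d : @chart R m M) (p : M) (f g : M -> R).

Lemma near_dom c p : chart_dom c p -> \forall q \near p, chart_dom c q.
Proof. by move=> cp; apply: open_nbhs_nbhs; split=> //; exact: chart_dom_open. Qed.

Lemma near_chart_inv c p : chart_dom c p -> \forall x \near c p,
  chart_dom c (chart_inv c x) /\ c (chart_inv c x) = x.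
Proof.
move=> cp; have : nbhs (c p) (c @` chart_dom c).
  by apply: open_nbhs_nbhs; split; [exact: chart_img_open|exists p].
by apply: filterS => x [q cq <-]; rewrite chart_funK.
Qed.

Lemma near_pull c p (P : set M) : chart_dom c p ->
  (\forall q \near p, P q) -> \forall x \near c p, P (chart_inv c x).
Proof.
move=> cp; have H : chart_inv c x @[x --> c p] --> p.
  by rewrite -[X in _ --> X](chart_funK cp); exact: chart_inv_cts.
exact: H.
Qed.

Lemma near_push c p (P : set 'rV[R]_m) : chart_dom c p ->
  (\forall x \near c p, P x) -> \forall q \near p, P (c q).
Proof. by move=> cp; exact: (chart_fun_cts cp). Qed.

(** The definition quantifies over all charts around [p]; one is enough because transition maps are
    smooth. *)
Lemma smooth_fun_atP c p f : atlas c -> chart_dom c p ->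
  smooth_fun_at p f <-> smooth_at (f \o chart_inv c) (c p).
Proof.
move=> ac cp; split=> [|sf d ad dp]; first exact.
apply: (@smooth_at_ext _ _ ((f \o chart_inv c) \o (c \o chart_inv d))).
  have := near_pull dp (near_dom cp); apply: filterS => x cx /=.
  by rewrite chart_funK.
apply: smooth_at_comp => [|j] /=; first by rewrite chart_funK.
exact: (atlas_compat ad ac).
Qed.

Lemma smooth_fun_at_ext p f g :
  (\forall q \near p, f q = g q) -> smooth_fun_at p f -> smooth_fun_at p g.
Proof.
by move=> fg sf c ac cp; apply: smooth_at_ext (sf c ac cp); exact: near_pull fg.
Qed.

Lemma smooth_fun_at_near p f :
  smooth_fun_at p f -> \forall q \near p, smooth_fun_at q f.
Proof.
move=> sf; have [c ac cp] := atlas_cover p.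
have := near_push cp (smooth_at_near (sf c ac cp)).
apply: filterS2 (near_dom cp) => q cq; exact: (smooth_fun_atP _ ac cq).2.
Qed.

Lemma smooth_fun_at_cst p a : smooth_fun_at p (fun _ : M => a).
Proof. by move=> c ac cp; exact: smooth_at_cst. Qed.

Lemma smooth_fun_atD p f g : smooth_fun_at p f -> smooth_fun_at p g ->
  smooth_fun_at p (fun q => f q + g q).
Proof. by move=> sf sg c ac cp; exact: smooth_atD (sf c ac cp) (sg c ac cp). Qed.

Lemma smooth_fun_atM p f g : smooth_fun_at p f -> smooth_fun_at p g ->
  smooth_fun_at p (fun q => f q * g q).
Proof. by move=> sf sg c ac cp; exact: smooth_atM (sf c ac cp) (sg c ac cp). Qed.

Lemma smooth_fun_atV p f : f p != 0 -> smooth_fun_at p f ->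
  smooth_fun_at p (fun q => (f q)^-1).
Proof.
move=> f0 sf c ac cp; apply: (smooth_atV _ (sf c ac cp)).
by rewrite /= chart_funK.
Qed.

Lemma smooth_fun_at_sum p I (r : seq I) (P : pred I) (f : I -> M -> R) :
  (forall i, smooth_fun_at p (f i)) ->
  smooth_fun_at p (fun q => \sum_(i <- r | P i) f i q).
Proof.
move=> sf; elim: r => [|i r IH].
  apply: (@smooth_fun_at_ext _ (fun=> 0)); last exact: smooth_fun_at_cst.
  by near=> q; rewrite big_nil.
case Pi: (P i); last first.
  by apply: smooth_fun_at_ext IH; near=> q; rewrite big_cons Pi.
apply: (@smooth_fun_at_ext _ (fun q => f i q + \sum_(j <- r | P j) f j q)).
  by near=> q; rewrite big_cons Pi.
exact: smooth_fun_atD.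
Unshelve. all: by end_near. Qed.

Lemma smooth_fun_at_prod p I (r : seq I) (P : pred I) (f : I -> M -> R) :
  (forall i, smooth_fun_at p (f i)) ->
  smooth_fun_at p (fun q => \prod_(i <- r | P i) f i q).
Proof.
move=> sf; elim: r => [|i r IH].
  apply: (@smooth_fun_at_ext _ (fun=> 1)); last exact: smooth_fun_at_cst.
  by near=> q; rewrite big_nil.
case Pi: (P i); last first.
  by apply: smooth_fun_at_ext IH; near=> q; rewrite big_cons Pi.
apply: (@smooth_fun_at_ext _ (fun q => f i q * \prod_(j <- r | P j) f j q)).
  by near=> q; rewrite big_cons Pi.
exact: smooth_fun_atM.
Unshelve. all: by end_near. Qed.

(** Entrywise smoothness, for the matrix formula of the orthogonal projections. *)
Definition smooth_mx_at k l p (A : M -> 'M[R]_(k, l)) :=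
  forall i j, smooth_fun_at p (fun q => A q i j).

Lemma smooth_mx_at_mul k l r p (A : M -> 'M[R]_(k, l)) (B : M -> 'M[R]_(l, r)) :
  smooth_mx_at p A -> smooth_mx_at p B -> smooth_mx_at p (fun q => A q *m B q).
Proof.
move=> sA sB i j.
apply: (@smooth_fun_at_ext _ (fun q => \sum_h A q i h * B q h j)).
  by near=> q; rewrite mxE.
by apply: smooth_fun_at_sum => h; exact: smooth_fun_atM.
Unshelve. all: by end_near. Qed.

Lemma smooth_mx_at_tr k l p (A : M -> 'M[R]_(k, l)) :
  smooth_mx_at p A -> smooth_mx_at p (fun q => (A q)^T).
Proof.
move=> sA i j; apply: smooth_fun_at_ext (sA j i).
by near=> q; rewrite mxE.
Unshelve. all: by end_near. Qed.

Lemma smooth_fun_at_det k p (A : M -> 'M[R]_k) :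
  smooth_mx_at p A -> smooth_fun_at p (fun q => \det (A q)).
Proof.
move=> sA; apply: smooth_fun_at_sum => s.
apply: smooth_fun_atM; first exact: smooth_fun_at_cst.
by apply: smooth_fun_at_prod => i; exact: sA.
Qed.

(** Cramer's rule: the entries of the inverse are cofactors, polynomial in those of [A], divided by
    a determinant that does not vanish. *)
Lemma smooth_mx_at_inv k p (A : M -> 'M[R]_k) :
  (\forall q \near p, A q \in unitmx) ->
  smooth_mx_at p A -> smooth_mx_at p (fun q => invmx (A q)).
Proof.
move=> uA sA i j.
apply: (@smooth_fun_at_ext _ (fun q => (\det (A q))^-1 * \adj (A q) i j)).
  by apply: filterS uA => q uA; rewrite /invmx uA !mxE.
apply: smooth_fun_atM.
  apply: smooth_fun_atV; last exact: smooth_fun_at_det.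
  by have := nbhs_singleton uA; rewrite unitmxE unitfE.
apply: (@smooth_fun_at_ext _ (fun q =>
    (-1) ^+ (j + i) * \det (row' j (col' i (A q))))).
  by near=> q; rewrite mxE.
apply: smooth_fun_atM; first exact: smooth_fun_at_cst.
apply: smooth_fun_at_det => a b; apply: smooth_fun_at_ext (sA (lift j a) (lift i b)).
by near=> q; rewrite !mxE.
Unshelve. all: by end_near. Qed.

Lemma smooth_fun_at_coord c p j : atlas c -> chart_dom c p ->
  smooth_fun_at p (fun q => c q 0 j).
Proof. by move=> ac cp d ad dp; exact: (atlas_compat ad ac). Qed.

End SmoothOnManifolds.

Section TangentVectors.
Context {R : realType} {m : nat} {M : @manifold R m}.
Implicit Types (c d : @chart R m M) (p : M) (f g : M -> R) (u v : vec M).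

Lemma vecDE u v f : (u + v) f = u f + v f.
Proof. by []. Qed.

Lemma vecNE v f : (- v) f = - v f.
Proof. by []. Qed.

Lemma vecZE a v f : (a *: v) f = a * v f.
Proof. by []. Qed.

Lemma vec_sumE k (v : 'I_k -> vec M) f : (\sum_j v j) f = \sum_j v j f.
Proof. by rewrite fct_sumE. Qed.

Lemma on_smoothE p v f : smooth_fun_at p f -> on_smooth p v f = v f.
Proof. by move=> sf; rewrite /on_smooth asboolT. Qed.

Lemma on_smooth_out p v f : ~ smooth_fun_at p f -> on_smooth p v f = 0.
Proof. by move=> sf; rewrite /on_smooth asboolF. Qed.

Lemma tangent_out p v f : tangent p v -> ~ smooth_fun_at p f -> v f = 0.
Proof. by move=> [c [_ _ [w ->]]] sf; rewrite on_smooth_out. Qed.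

Lemma on_smooth_tangent p v : tangent p v -> on_smooth p v = v.
Proof.
move=> tv; apply/funext => f; have [sf|sf] := pselect (smooth_fun_at p f).
  by rewrite on_smoothE.
by rewrite on_smooth_out // (tangent_out tv).
Qed.

(** Derivatives are local. When [f] is not smooth at [p], neither is [g], and both values are 0 by
    the convention built into [on_smooth]. *)
Lemma tangent_ext p v f g : tangent p v ->
  (\forall q \near p, f q = g q) -> v f = v g.
Proof.
move=> tv fg; have gf : \forall q \near p, g q = f q by apply: filterS fg.
have [sf|sf] := pselect (smooth_fun_at p f); last first.
  by rewrite !(tangent_out tv) // => /(smooth_fun_at_ext gf).
have sg := smooth_fun_at_ext fg sf.
case: tv => c [ac cp [w ->]]; rewrite !on_smoothE //.
by apply: near_eq_derive; exact: (near_pull cp fg).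
Qed.

Lemma tangent_cst p v a : tangent p v -> v (fun=> a) = 0.
Proof.
move=> [c [ac cp [w ->]]]; rewrite on_smoothE; last exact: smooth_fun_at_cst.
exact: derive_cst.
Qed.

Lemma tangentD p v f g : tangent p v -> smooth_fun_at p f -> smooth_fun_at p g ->
  v (fun q => f q + g q) = v f + v g.
Proof.
move=> [c [ac cp [w ->]]] sf sg; rewrite !on_smoothE //; last exact: smooth_fun_atD.
rewrite -deriveD //.
  by apply: diff_derivable; apply: smooth_at_differentiable; exact: sf.
by apply: diff_derivable; apply: smooth_at_differentiable; exact: sg.
Qed.

Lemma tangentM p v f g : tangent p v -> smooth_fun_at p f -> smooth_fun_at p g ->
  v (fun q => f q * g q) = f p * v g + g p * v f.
Proof.
move=> [c [ac cp [w ->]]] sf sg; rewrite !on_smoothE //; last exact: smooth_fun_atM.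
have -> : (fun q => f q * g q) \o chart_inv c =
  (f \o chart_inv c) * (g \o chart_inv c) by [].
rewrite deriveM /= ?chart_funK //.
  by apply: diff_derivable; apply: smooth_at_differentiable; exact: sf.
by apply: diff_derivable; apply: smooth_at_differentiable; exact: sg.
Qed.

(** The coordinate field d/dx_j of the chart [c], meaningful on [chart_dom c] only. *)
Definition coord_vec c (j : 'I_m) (p : M) : vec M :=
  on_smooth p (fun f => 'D_(delta_mx 0 j) (f \o chart_inv c) (c p)).

Lemma tangent_coord_vec c j p : atlas c -> chart_dom c p ->
  tangent p (coord_vec c j p).
Proof. by move=> ac cp; exists c; split=> //; exists (delta_mx 0 j). Qed.

Lemma tangent_lincomb c p (a : 'I_m -> R) : atlas c -> chart_dom c p ->
  tangent p (\sum_j a j *: coord_vec c j p).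
Proof.
move=> ac cp; exists c; split=> //; exists (\row_j a j).
apply/funext => f; rewrite vec_sumE /=.
have [sf|sf] := pselect (smooth_fun_at p f); last first.
  rewrite on_smooth_out //; apply: big1 => j _.
  by rewrite vecZE /coord_vec on_smooth_out // mulr0.
rewrite on_smoothE // derive_linear; last first.
  by apply: smooth_at_differentiable; exact: sf.
by apply: eq_bigr => j _; rewrite vecZE /coord_vec on_smoothE.
Qed.

Lemma coord_vec_smooth c j p f : atlas c -> chart_dom c p ->
  smooth_fun_at p f -> smooth_fun_at p (fun q => coord_vec c j q f).
Proof.
move=> ac cp sf.
apply: (@smooth_fun_at_ext _ _ _ _
    (fun q => 'D_(delta_mx 0 j) (f \o chart_inv c) (c q))).
  by apply: filterS (smooth_fun_at_near sf) => q sfq; rewrite /coord_vec on_smoothE.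
apply/(smooth_fun_atP _ ac cp).
apply: smooth_at_ext (smooth_at_derive (delta_mx 0 j) (sf c ac cp)).
by apply: filterS (near_chart_inv cp) => x [_ E] /=; rewrite E.
Qed.

Lemma coord_vec_coord c i j p : atlas c -> chart_dom c p ->
  coord_vec c i p (fun q => c q 0 j) = (i == j)%:R.
Proof.
move=> ac cp; rewrite /coord_vec on_smoothE; last exact: smooth_fun_at_coord.
rewrite (@near_eq_derive _ _ _ _ (fun x : 'rV[R]_m => x 0 j)); last first.
  by apply: filterS (near_chart_inv cp) => x [_ E] /=; rewrite E.
have d : derivable (id : 'rV[R]_m -> _) (c p) (delta_mx 0 i) by [].
have := derive_mx d; rewrite derive_id => /matrixP/(_ 0 j).
by rewrite !mxE eqxx /= eq_sym => <-.
Qed.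

End TangentVectors.

(** * Pushforward and vector fields *)

Section Pushforward.
Context {R : realType} {m n : nat} {M : @manifold R m} {N : @manifold R n}.
Variables (F : M -> N).

Lemma differentialE p (v : vec M) f :
  smooth_fun_at (F p) f -> differential F p v f = v (f \o F).
Proof. exact: on_smoothE. Qed.

Lemma differential_linear p a (u v : vec M) :
  differential F p (a *: u + v) = a *: differential F p u + differential F p v.
Proof.
apply/funext => f; rewrite vecDE vecZE.
have [sf|sf] := pselect (smooth_fun_at (F p) f).
  by rewrite !differentialE.
by rewrite /differential !on_smooth_out // mulr0 addr0.
Qed.

Lemma differential0 p : differential F p 0 = 0.
Proof.
apply/funext => f; have [sf|sf] := pselect (smooth_fun_at (F p) f).
  by rewrite differentialE.
by rewrite /differential on_smooth_out.
Qed.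

Lemma differentialD p (u v : vec M) :
  differential F p (u + v) = differential F p u + differential F p v.
Proof. by have := differential_linear p 1 u v; rewrite !scale1r. Qed.

Lemma differentialZ p a (u : vec M) :
  differential F p (a *: u) = a *: differential F p u.
Proof. by have := differential_linear p a u 0; rewrite differential0 !addr0. Qed.

Lemma differentialB p (u v : vec M) :
  differential F p (u - v) = differential F p u - differential F p v.
Proof. by rewrite differentialD -[- v]scaleN1r differentialZ scaleN1r. Qed.

Hypothesis sF : smooth_map F.

(** Chain rule for [f \o F] read through the chart [d] of the target. The chart that witnesses
    [tangent p v] is unrelated to [d], so for the identity map this is the change-of-chart
    formula. *)
Lemma differential_coord p (v : vec M) (d : chart n N) :
  tangent p v -> atlas d -> chart_dom d (F p) ->
  differential F p v = \sum_j v (fun q => d (F q) 0 j) *: coord_vec d j (F p).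
Proof.
move=> tv ad dp; apply/funext => f; rewrite vec_sumE.
have [sf|sf] := pselect (smooth_fun_at (F p) f); last first.
  rewrite /differential on_smooth_out //; apply/esym; apply: big1 => j _.
  by rewrite vecZE /coord_vec on_smooth_out // mulr0.
rewrite differentialE //.
have sdF j : smooth_fun_at p (fun q => d (F q) 0 j).
  by apply: (sF.2 p (fun y => d y 0 j)); exact: smooth_fun_at_coord.
have sfF : smooth_fun_at p (f \o F) by exact: sF.2.
case: tv => c [ac cp [w ->]]; rewrite on_smoothE //.
have dE : \row_j d (F (chart_inv c (c p))) 0 j = d (F p).
  by apply/rowP => j; rewrite mxE chart_funK.
rewrite (@near_eq_derive _ _ _ _
    (fun x => (f \o chart_inv d) (\row_j d (F (chart_inv c x)) 0 j))).
  rewrite derive_comp_row; first last.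
  - by rewrite dE; apply: smooth_at_differentiable; exact: sf.
  - by move=> j; apply: smooth_at_differentiable; exact: (sdF j).
  apply: eq_bigr => j _; rewrite dE vecZE /coord_vec !on_smoothE //.
have dF : \forall q \near p, chart_dom d (F q) := sF.1 p _ (near_dom dp).
apply: filterS (near_pull cp dF) => x dx /=.
rewrite (_ : \row_j _ = d (F (chart_inv c x))) ?chart_funK //.
by apply/rowP => j; rewrite mxE.
Qed.

End Pushforward.

Section TangentSpace.
Context {R : realType} {m : nat} {M : @manifold R m}.
Implicit Types (c : @chart R m M) (p : M) (f : M -> R) (u v : vec M).

Lemma smooth_map_id : smooth_map (@idfun M).
Proof. by split=> // p; exact: cvg_id. Qed.

Lemma tangent_coord p v c : tangent p v -> atlas c -> chart_dom c p ->
  v = \sum_j v (fun q => c q 0 j) *: coord_vec c j p.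
Proof.
by move=> tv ac cp; rewrite -[LHS](on_smooth_tangent tv);
  exact: (differential_coord smooth_map_id tv ac cp).
Qed.

Lemma tangent_eq p u v c : tangent p u -> tangent p v -> atlas c ->
  chart_dom c p ->
  (forall j, u (fun q => c q 0 j) = v (fun q => c q 0 j)) -> u = v.
Proof.
move=> tu tv ac cp uv; rewrite (tangent_coord tu ac cp) (tangent_coord tv ac cp).
by apply: eq_bigr => j _; rewrite uv.
Qed.

(** The two vectors may be witnessed by different charts; both are first expanded in the same
    one. *)
Lemma tangent_linear p a u v : tangent p u -> tangent p v ->
  tangent p (a *: u + v).
Proof.
move=> tu tv; have [c ac cp] := atlas_cover p.
rewrite (tangent_coord tu ac cp) (tangent_coord tv ac cp) scaler_sumr -big_split /=.
set s := (X in tangent p X).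
have -> : s = \sum_j (a * u (fun q => c q 0 j) + v (fun q => c q 0 j)) *:
    coord_vec c j p.
  by apply: eq_bigr => j _; rewrite scalerA scalerDl.
exact: tangent_lincomb.
Qed.

Lemma tangent0 p : tangent p (0 : vec M).
Proof.
have [c ac cp] := atlas_cover p; have := tangent_lincomb (fun=> 0) ac cp.
by rewrite big1 // => j _; rewrite scale0r.
Qed.

Lemma tangent_add p u v : tangent p u -> tangent p v -> tangent p (u + v).
Proof. by move=> tu tv; have := tangent_linear 1 tu tv; rewrite scale1r. Qed.

Lemma tangent_scale p a u : tangent p u -> tangent p (a *: u).
Proof. by move=> tu; have := tangent_linear a tu (tangent0 p); rewrite addr0. Qed.

Lemma tangent_opp p u : tangent p u -> tangent p (- u).
Proof. by move=> /(tangent_scale (-1)); rewrite scaleN1r. Qed.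

Lemma tangent_sub p u v : tangent p u -> tangent p v -> tangent p (u - v).
Proof. by move=> tu tv; apply: tangent_add => //; exact: tangent_opp. Qed.

Section LinearOn.
Variables (p : M) (W : lmodType R) (L : vec M -> W).
Hypothesis linL : linear_on (tangent p) L.

Lemma linear_on0 : L 0 = 0.
Proof.
have := linL 1 (tangent0 p) (tangent0 p); rewrite !scale1r addr0.
by move=> /(congr1 (fun w => w - L 0)); rewrite subrr addrK => /esym.
Qed.

Lemma linear_onD u v : tangent p u -> tangent p v -> L (u + v) = L u + L v.
Proof. by move=> tu tv; have := linL 1 tu tv; rewrite !scale1r. Qed.

Lemma linear_onZ a u : tangent p u -> L (a *: u) = a *: L u.
Proof.
by move=> tu; have := linL a tu (tangent0 p); rewrite linear_on0 !addr0.
Qed.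

Lemma linear_onN u : tangent p u -> L (- u) = - L u.
Proof. by move=> /(linear_onZ (-1)); rewrite !scaleN1r. Qed.

Lemma linear_onB u v : tangent p u -> tangent p v -> L (u - v) = L u - L v.
Proof.
by move=> tu tv; rewrite linear_onD //; [rewrite linear_onN|exact: tangent_opp].
Qed.

(** Tangency is proved together with linearity because the induction step applies [L] to a partial
    sum, where linearity requires a tangent vector. *)
Lemma linear_on_sum k (a : 'I_k -> R) (v : 'I_k -> vec M) :
  (forall j, tangent p (v j)) ->
  tangent p (\sum_j a j *: v j) /\ L (\sum_j a j *: v j) = \sum_j a j *: L (v j).
Proof.
move=> tv; elim: k a v tv => [|k IH] a v tv.
  by rewrite !big_ord0; split; [exact: tangent0|exact: linear_on0].
rewrite !big_ord_recl; have [t E] := IH (a \o lift ord0) (v \o lift ord0) (fun j => tv _).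
have ta := tangent_scale (a ord0) (tv ord0).
split; first exact: tangent_add.
by rewrite linear_onD // linear_onZ // E.
Qed.

End LinearOn.

End TangentSpace.

Section Fields.
Context {R : realType} {m n : nat} {M : @manifold R m} {N : @manifold R n}.
Variable (F : M -> N).
Hypothesis sF : smooth_map F.
Implicit Types (p : M) (Y Z : M -> vec N) (d : @chart R n N).

Lemma field_along_tangent p Y : field_along_at F p Y -> tangent (F p) (Y p).
Proof. by move=> [/nbhs_singleton]. Qed.

Lemma smooth_comp p f : smooth_fun_at (F p) f -> smooth_fun_at p (f \o F).
Proof. exact: sF.2. Qed.

Lemma near_comp p (P : set N) :
  (\forall y \near F p, P y) -> \forall q \near p, P (F q).
Proof. exact: (sF.1 p). Qed.

Lemma field_along_ext p Y Z : (\forall q \near p, Y q = Z q) ->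
  field_along_at F p Y -> field_along_at F p Z.
Proof.
move=> YZ [tY sY]; split; first by apply: filterS2 YZ tY => q ->.
by move=> f /sY; apply: smooth_fun_at_ext; apply: filterS YZ => q ->.
Qed.

Lemma field_along0 p : field_along_at F p (fun=> 0).
Proof.
split; first by near=> q; exact: tangent0.
by move=> f _; exact: (smooth_fun_at_cst 0).
Unshelve. all: by end_near. Qed.

Lemma field_alongD p Y Z : field_along_at F p Y -> field_along_at F p Z ->
  field_along_at F p (fun q => Y q + Z q).
Proof.
move=> [tY sY] [tZ sZ]; split.
  by apply: filterS2 tY tZ => q; exact: tangent_add.
by move=> f sf; exact: smooth_fun_atD (sY f sf) (sZ f sf).
Qed.

Lemma field_alongZ p a Y : smooth_fun_at p a -> field_along_at F p Y ->
  field_along_at F p (fun q => a q *: Y q).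
Proof.
move=> sa [tY sY]; split.
  by apply: filterS tY => q; exact: tangent_scale.
by move=> f sf; exact: smooth_fun_atM sa (sY f sf).
Qed.

Lemma field_alongN p Y : field_along_at F p Y -> field_along_at F p (fun q => - Y q).
Proof.
move=> fY; apply: field_along_ext (field_alongZ (smooth_fun_at_cst (-1)) fY).
by near=> q; rewrite scaleN1r.
Unshelve. all: by end_near. Qed.

Lemma field_alongB p Y Z : field_along_at F p Y -> field_along_at F p Z ->
  field_along_at F p (fun q => Y q - Z q).
Proof. by move=> fY fZ; exact: field_alongD fY (field_alongN fZ). Qed.

Lemma field_along_sum p k (Y : 'I_k -> M -> vec N) :
  (forall j, field_along_at F p (Y j)) ->
  field_along_at F p (fun q => \sum_j Y j q).
Proof.
elim: k Y => [|k IH] Y fY.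
  apply: field_along_ext (field_along0 p).
  by near=> q; rewrite big_ord0.
apply: (@field_along_ext _ (fun q => Y ord0 q + \sum_j Y (lift ord0 j) q)).
  by near=> q; rewrite big_ord_recl.
by apply: field_alongD => //; exact: IH.
Unshelve. all: by end_near. Qed.

Lemma field_along_coord p Y d : field_along_at F p Y -> atlas d ->
  chart_dom d (F p) ->
  \forall q \near p, Y q = \sum_j Y q (fun y => d y 0 j) *: coord_vec d j (F q).
Proof.
move=> [tY _] ad dp; apply: filterS2 tY (near_comp (near_dom dp)) => q tY dq.
exact: tangent_coord.
Qed.

Lemma field_coord_vec y d j : atlas d -> chart_dom d y -> field_at y (coord_vec d j).
Proof.
move=> ad dy; split.
  by apply: filterS (near_dom dy) => z; exact: tangent_coord_vec.
by move=> f; exact: coord_vec_smooth.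
Qed.

Lemma field_along_comp p (Y : N -> vec N) :
  field_at (F p) Y -> field_along_at F p (Y \o F).
Proof.
move=> [tY sY]; split; first exact: (near_comp tY).
by move=> f /sY; exact: smooth_comp.
Qed.

Lemma tangent_differential p v : tangent p v -> tangent (F p) (differential F p v).
Proof.
move=> tv; have [d ad dp] := atlas_cover (F p).
by rewrite (differential_coord sF tv ad dp); exact: tangent_lincomb.
Qed.

Lemma field_along_differential p (X : M -> vec M) : field_at p X ->
  field_along_at F p (fun q => differential F q (X q)).
Proof.
move=> [tX sX]; split; first by apply: filterS tX => q; exact: tangent_differential.
move=> f sf; apply: smooth_fun_at_ext (sX _ (smooth_comp sf)).
apply: filterS (near_comp (smooth_fun_at_near sf)) => q sfq.
by rewrite differentialE.
Qed.

End Fields.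

(** * Orthogonal projections of a submersion *)

Section Metric.
Context {R : realType} {m : nat} {M : @manifold R m}.
Variable g : M -> vec M -> vec M -> R.
Hypothesis gP : riemannian_metric g.
Implicit Types (p : M) (u v w : vec M).

Lemma metricDl p u v w : tangent p u -> tangent p v -> tangent p w ->
  g p (u + v) w = g p u w + g p v w.
Proof. by move=> tu tv tw; exact: (linear_onD (Defs.metric_linear gP tw)). Qed.

Lemma metricZl p a u w : tangent p u -> tangent p w ->
  g p (a *: u) w = a * g p u w.
Proof. by move=> tu tw; exact: (linear_onZ (Defs.metric_linear gP tw)). Qed.

Lemma metricNl p u w : tangent p u -> tangent p w -> g p (- u) w = - g p u w.
Proof. by move=> tu tw; exact: (linear_onN (Defs.metric_linear gP tw)). Qed.

Lemma metricBl p u v w : tangent p u -> tangent p v -> tangent p w ->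
  g p (u - v) w = g p u w - g p v w.
Proof. by move=> tu tv tw; exact: (linear_onB (Defs.metric_linear gP tw)). Qed.

Lemma metric0l p w : tangent p w -> g p 0 w = 0.
Proof. by move=> tw; exact: (linear_on0 (Defs.metric_linear gP tw)). Qed.

Lemma metricDr p u v w : tangent p u -> tangent p v -> tangent p w ->
  g p w (u + v) = g p w u + g p w v.
Proof.
move=> tu tv tw; rewrite !(Defs.metric_sym gP tw) ?metricDl //; exact: tangent_add.
Qed.

Lemma metricZr p a u w : tangent p u -> tangent p w ->
  g p w (a *: u) = a * g p w u.
Proof.
move=> tu tw; rewrite !(Defs.metric_sym gP tw) ?metricZl //; exact: tangent_scale.
Qed.

Lemma metricNr p u w : tangent p u -> tangent p w -> g p w (- u) = - g p w u.
Proof.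
move=> tu tw; rewrite !(Defs.metric_sym gP tw) ?metricNl //; exact: tangent_opp.
Qed.

Lemma metric_ge0 p v : tangent p v -> 0 <= g p v v.
Proof.
move=> tv; have [->|v0] := pselect (v = 0); first by rewrite metric0l //; exact: tangent0.
exact: ltW (Defs.metric_pos gP tv v0).
Qed.

Lemma metric_eq0 p v : tangent p v -> g p v v = 0 -> v = 0.
Proof.
move=> tv gv; have [//|v0] := pselect (v = 0).
by have := Defs.metric_pos gP tv v0; rewrite gv ltxx.
Qed.

Lemma metric_suml p k (a : 'I_k -> R) (v : 'I_k -> vec M) w :
  (forall j, tangent p (v j)) -> tangent p w ->
  g p (\sum_j a j *: v j) w = \sum_j a j * g p (v j) w.
Proof. by move=> tv tw; have [] := linear_on_sum (Defs.metric_linear gP tw) a tv. Qed.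

Lemma metric_sumr p k (a : 'I_k -> R) (v : 'I_k -> vec M) w :
  (forall j, tangent p (v j)) -> tangent p w ->
  g p w (\sum_j a j *: v j) = \sum_j a j * g p w (v j).
Proof.
move=> tv tw; have [ts _] := linear_on_sum (Defs.metric_linear gP tw) a tv.
rewrite (Defs.metric_sym gP) // metric_suml //.
by apply: eq_bigr => j _; rewrite (Defs.metric_sym gP).
Qed.

End Metric.

Lemma unitmx_of_inj (K : fieldType) k (A : 'M[K]_k) :
  (forall x : 'rV_k, x *m A = 0 -> x = 0) -> A \in unitmx.
Proof. by move=> Ainj; rewrite -row_free_unit; exact: inj_row_free. Qed.

Section Projections.
Context {R : realType} {m n : nat} {M : @manifold R m} {N : @manifold R n}.
Variables (g : M -> vec M -> vec M -> R) (gN : N -> vec N -> vec N -> R).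
Variable F : M -> N.
Hypotheses (gP : riemannian_metric g) (subF : riemannian_submersion g gN F).
Implicit Types (p : M) (u v w : vec M).

Let sF : smooth_map F := rs_smooth subF.

Lemma vertical0 p : vertical F p 0.
Proof. by split; [exact: tangent0|exact: differential0]. Qed.

Lemma vertical_linear p a u v : vertical F p u -> vertical F p v ->
  vertical F p (a *: u + v).
Proof.
move=> [tu u0] [tv v0]; split; first exact: tangent_linear.
by rewrite differential_linear u0 v0 scaler0 addr0.
Qed.

Lemma vertical_sub p u v : vertical F p u -> vertical F p v ->
  vertical F p (u - v).
Proof.
by move=> uv vv; have := vertical_linear (-1) vv uv; rewrite scaleN1r addrC.
Qed.

Lemma horizontal_linear p a u v : horizontal g F p u -> horizontal g F p v ->
  horizontal g F p (a *: u + v).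
Proof.
move=> [tu hu] [tv hv]; split; first exact: tangent_linear.
move=> w vw; have tw := vw.1; rewrite metricDl ?metricZl //.
  by rewrite hu // hv // mulr0 addr0.
exact: tangent_scale.
Qed.

Lemma horizontal_sub p u v : horizontal g F p u -> horizontal g F p v ->
  horizontal g F p (u - v).
Proof.
by move=> uv vv; have := horizontal_linear (-1) vv uv; rewrite scaleN1r addrC.
Qed.

Lemma vertical_horizontal0 p v : vertical F p v -> horizontal g F p v -> v = 0.
Proof. by move=> vv [tv /(_ _ vv)]; exact: metric_eq0. Qed.

(** A difference of two candidates is both vertical and horizontal, hence 0; so whatever [xget]
    picks is [u]. *)
Lemma Vproj_eq p v u : vertical F p u -> horizontal g F p (v - u) ->
  Vproj g F p v = u.
Proof.
move=> vu hu; rewrite /Vproj; case: xgetP => [w _ [vw hw]|/(_ u)]; last first.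
  by case.
apply/eqP; rewrite -subr_eq0; apply/eqP; apply: (@vertical_horizontal0 p).
  exact: vertical_sub.
have -> : w - u = (v - u) - (v - w).
  by rewrite opprB [RHS]addrC addrA subrK.
exact: horizontal_sub.
Qed.

(** * The orthogonal projections in charts of the source and the target *)

Section Frame.
Variables (c : @chart R m M) (d : @chart R n N).
Hypotheses (ac : atlas c) (ad : atlas d).

Let coords v : 'rV[R]_m := \row_j v (fun q => c q 0 j).
Let frame p (x : 'rV[R]_m) : vec M := \sum_j x 0 j *: coord_vec c j p.
Let gram p : 'M[R]_m := \matrix_(i, j) g p (coord_vec c i p) (coord_vec c j p).
Let jac p : 'M[R]_(m, n) :=
  \matrix_(i, j) coord_vec c i p (fun q => d (F q) 0 j).
(** The Gram matrix of the gradients of the coordinates of [F]: the rows of J^T G^-1 are the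
    components of these gradients, with J = [jac p] and G = [gram p]. *)
Let cogram p : 'M[R]_n := (jac p)^T *m invmx (gram p) *m jac p.
(* The matrix, acting on row vectors, of the orthogonal projection onto
   the span of the gradients of the coordinates of F. *)
Let hor p : 'M[R]_m :=
  jac p *m invmx (cogram p) *m ((jac p)^T *m invmx (gram p)).

Section AtPoint.
Variable p : M.
Hypotheses (cp : chart_dom c p) (dp : chart_dom d (F p)).

Let tframe x : tangent p (frame p x).
Proof. exact: tangent_lincomb. Qed.

Let coordsK v : tangent p v -> frame p (coords v) = v.
Proof.
move=> tv; rewrite [RHS](tangent_coord tv ac cp).
by apply: eq_bigr => j _; rewrite mxE.
Qed.

Let frameK x : coords (frame p x) = x.
Proof.
apply/rowP => j; rewrite mxE /frame vec_sumE (bigD1 j) //= big1 => [|i ij].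
  by rewrite vecZE coord_vec_coord // eqxx mulr1 addr0.
by rewrite vecZE coord_vec_coord // (negbTE ij) mulr0.
Qed.

Let gramE x y : g p (frame p x) (frame p y) = (x *m gram p *m y^T) 0 0.
Proof.
have tc j : tangent p (coord_vec c j p) by exact: tangent_coord_vec.
rewrite metric_sumr // mxE; apply: eq_bigr => j _; rewrite metric_suml // !mxE.
by rewrite mulrC; congr (_ * _); apply: eq_bigr => i _; rewrite !mxE.
Qed.

Let gram_sym : (gram p)^T = gram p.
Proof.
by apply/matrixP => i j; rewrite !mxE (Defs.metric_sym gP) //;
  exact: tangent_coord_vec.
Qed.

Let gram_def (x : 'rV_m) : (x *m gram p *m x^T) 0 0 = 0 -> x = 0.
Proof.
rewrite -gramE => /(metric_eq0 gP (tframe x)) E.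
by rewrite -[LHS]frameK E; apply/rowP => j; rewrite !mxE.
Qed.

Lemma gram_unit : gram p \in unitmx.
Proof.
by apply: unitmx_of_inj => x xG; apply: gram_def; rewrite xG mul0mx mxE.
Qed.

Let differential_frame x j :
  differential F p (frame p x) (fun y => d y 0 j) = (x *m jac p) 0 j.
Proof.
rewrite differentialE; last exact: smooth_fun_at_coord.
by rewrite /frame vec_sumE mxE; apply: eq_bigr => i _; rewrite mxE.
Qed.

Let vertical_frame x : vertical F p (frame p x) <-> x *m jac p = 0.
Proof.
split=> [[_ E]|E].
  by apply/rowP => j; rewrite -differential_frame E mxE.
split=> //; apply: (tangent_eq _ (tangent0 _) ad dp) => [|j].
  exact: tangent_differential.
by rewrite differential_frame E mxE.
Qed.

(** If x annihilates J^T G^-1 J, the vector with components x J^T G^-1 has length 0, so x J^T = 0.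
    Maximal rank puts every basis vector in the row space of J, which forces x = 0. *)
Lemma cogram_unit : cogram p \in unitmx.
Proof.
apply: unitmx_of_inj => x; rewrite /cogram !mulmxA => xK.
have xJ : x *m (jac p)^T = 0.
  suff : x *m (jac p)^T *m invmx (gram p) = 0.
    by move=> /(congr1 (fun A => A *m gram p)); rewrite mulmxKV ?gram_unit // mul0mx.
  apply: gram_def; rewrite trmx_mul trmx_mul trmxK trmx_inv gram_sym.
  by rewrite mulmxKV ?gram_unit // !mulmxA xK mul0mx mxE.
apply/rowP => j; rewrite [RHS]mxE.
have tj : tangent (F p) (coord_vec d j (F p)) by exact: tangent_coord_vec.
have [v tv vj] := rs_max_rank subF tj.
have vJ : coords v *m jac p = delta_mx 0 j.
  apply/rowP => i; rewrite -differential_frame coordsK // vj coord_vec_coord //.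
  by rewrite mxE eqxx eq_sym.
have : (delta_mx 0 j : 'rV_n) *m x^T = 0.
  by rewrite -vJ -mulmxA -[X in X *m x^T]trmxK -trmx_mul xJ trmx0 mulmx0.
by rewrite -rowE => /matrixP/(_ 0 0); rewrite !mxE.
Qed.

Let horizontal_hor (x : 'rV_m) : horizontal g F p (frame p (x *m hor p)).
Proof.
split=> // u uv; have tu := uv.1; move: uv.
rewrite -(coordsK tu) gramE => /vertical_frame uJ.
rewrite /hor !mulmxA mulmxKV ?gram_unit // -mulmxA -trmx_mul uJ trmx0 mulmx0.
by rewrite mxE.
Qed.

(** The last factors of [hor p *m jac p] form [cogram p] and cancel its inverse, so this product is
    [jac p]: [v] and its projection have the same image under F_*. *)
Let hor_vertical v : tangent p v ->
  vertical F p (v - frame p (coords v *m hor p)).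
Proof.
move=> tv.
have -> : v - frame p (coords v *m hor p) = frame p (coords v - coords v *m hor p).
  rewrite -{1}(coordsK tv) /frame -sumrB; apply: eq_bigr => j _.
  by rewrite !mxE scalerBl.
apply/vertical_frame; rewrite mulmxBl /hor -!mulmxA.
by rewrite [(jac p)^T *m _]mulmxA mulVmx ?cogram_unit // mulmx1 subrr.
Qed.

(** This is the existence of the orthogonal decomposition, without which [xget] would return its
    default 0, together with a formula that shows how it depends on the point. *)
Lemma Hproj_frame v : tangent p v ->
  vertical F p (Vproj g F p v) /\ Hproj g F p v = frame p (coords v *m hor p).
Proof.
move=> tv; rewrite /Hproj.
rewrite (@Vproj_eq p v (v - frame p (coords v *m hor p))).
- by split; [exact: hor_vertical|rewrite subKr].
- exact: hor_vertical.
- by rewrite subKr; exact: horizontal_hor.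
Qed.

Lemma horizontal_Hproj_frame v : tangent p v -> horizontal g F p (Hproj g F p v).
Proof. by move=> /Hproj_frame[_ ->]; exact: horizontal_hor. Qed.

End AtPoint.

(** The entries of [hor] are built by products and inverses from smooth matrices; [gram] and
    [cogram] are invertible at all points near [p], not just at [p]. *)
Lemma field_Hproj_frame p (X : M -> vec M) :
  chart_dom c p -> chart_dom d (F p) -> field_at p X ->
  field_at p (fun q => Hproj g F q (X q)).
Proof.
move=> cp dp fX; have nc := near_dom cp; have nd := near_comp sF (near_dom dp).
have sjac : smooth_mx_at p jac.
  move=> i j.
  have sd : smooth_fun_at p (fun q => d (F q) 0 j).
    exact: (smooth_comp sF (smooth_fun_at_coord j ad dp)).
  apply: smooth_fun_at_ext (coord_vec_smooth i ac cp sd).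
  by near=> q; rewrite mxE.
have sgram : smooth_mx_at p gram.
  move=> i j.
  have := metric_smooth gP (field_coord_vec i ac cp) (field_coord_vec j ac cp).
  by apply: smooth_fun_at_ext; near=> q; rewrite mxE.
have nG : \forall q \near p, gram q \in unitmx.
  by apply: filterS nc; exact: gram_unit.
have sG := smooth_mx_at_mul (smooth_mx_at_tr sjac) (smooth_mx_at_inv nG sgram).
have scogram := smooth_mx_at_mul sG sjac.
have shor : smooth_mx_at p hor.
  apply: (smooth_mx_at_mul _ sG); apply: (smooth_mx_at_mul sjac).
  by apply: smooth_mx_at_inv scogram; apply: filterS2 nc nd; exact: cogram_unit.
have scoords : smooth_mx_at p (fun q => coords (X q)).
  move=> i j; apply: smooth_fun_at_ext (fX.2 _ (smooth_fun_at_coord j ac cp)).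
  by near=> q; rewrite mxE.
have sa := smooth_mx_at_mul scoords shor.
apply: (@field_along_ext _ _ _ _ _ idfun _
    (fun q => frame q (coords (X q) *m hor q))).
  apply: filterS3 nc nd fX.1 => q cq dq tXq.
  by have [_ ->] := Hproj_frame cq dq tXq.
apply: field_along_sum => j; apply: field_alongZ => //.
exact: field_coord_vec.
Unshelve. all: by end_near. Qed.

End Frame.

Lemma vertical_Vproj p v : tangent p v -> vertical F p (Vproj g F p v).
Proof.
move=> tv; have [c ac cp] := atlas_cover p; have [d ad dp] := atlas_cover (F p).
by have [] := Hproj_frame ac ad cp dp tv.
Qed.

Lemma horizontal_Hproj p v : tangent p v -> horizontal g F p (Hproj g F p v).
Proof.
move=> tv; have [c ac cp] := atlas_cover p; have [d ad dp] := atlas_cover (F p).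
exact: (horizontal_Hproj_frame ac ad cp dp tv).
Qed.

Lemma field_Hproj p (X : M -> vec M) : field_at p X ->
  field_at p (fun q => Hproj g F q (X q)).
Proof.
have [c ac cp] := atlas_cover p; have [d ad dp] := atlas_cover (F p).
exact: (field_Hproj_frame ac ad cp dp).
Qed.

Lemma field_Vproj p (X : M -> vec M) : field_at p X ->
  field_at p (fun q => Vproj g F q (X q)).
Proof.
move=> fX; apply: field_along_ext (field_alongB fX (field_Hproj fX)).
by near=> q; rewrite /Hproj subKr.
Unshelve. all: by end_near. Qed.

Lemma VHprojK p v : Vproj g F p v + Hproj g F p v = v.
Proof. by rewrite /Hproj addrC subrK. Qed.

Lemma Vproj_vertical p v : vertical F p v -> Vproj g F p v = v.
Proof.
move=> vv; apply: Vproj_eq => //; rewrite subrr.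
by split; [exact: tangent0|move=> u [tu _]; exact: metric0l].
Qed.

Lemma Hproj_vertical p v : vertical F p v -> Hproj g F p v = 0.
Proof. by move=> vv; rewrite /Hproj Vproj_vertical // subrr. Qed.

Lemma Vproj_horizontal p v : horizontal g F p v -> Vproj g F p v = 0.
Proof. by move=> hv; apply: Vproj_eq; [exact: vertical0|rewrite subr0]. Qed.

Lemma Hproj_horizontal p v : horizontal g F p v -> Hproj g F p v = v.
Proof. by move=> hv; rewrite /Hproj Vproj_horizontal // subr0. Qed.

Lemma tangent_Vproj p v : tangent p v -> tangent p (Vproj g F p v).
Proof. by move=> /vertical_Vproj[]. Qed.

Lemma tangent_Hproj p v : tangent p v -> tangent p (Hproj g F p v).
Proof. by move=> /horizontal_Hproj[]. Qed.

Lemma metric_vert_hor p u x : vertical F p u -> horizontal g F p x -> g p u x = 0.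
Proof. by move=> vu [tx hx]; rewrite (Defs.metric_sym gP) ?hx //; exact: vu.1. Qed.

Lemma metric_Hproj p v x : tangent p v -> horizontal g F p x ->
  g p (Hproj g F p v) x = g p v x.
Proof.
move=> tv hx; rewrite -[in RHS](VHprojK p v) metricDl //.
- by rewrite (metric_vert_hor (vertical_Vproj tv) hx) add0r.
- exact: tangent_Vproj.
- exact: tangent_Hproj.
- exact: hx.1.
Qed.

Lemma metric_Vproj p v u : tangent p v -> vertical F p u ->
  g p (Vproj g F p v) u = g p v u.
Proof.
move=> tv vu; rewrite -[in RHS](VHprojK p v) metricDl //.
- by rewrite (horizontal_Hproj tv).2 // addr0.
- exact: tangent_Vproj.
- exact: tangent_Hproj.
- exact: vu.1.
Qed.

End Projections.

(** * Connections and cosymplectic manifolds *)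

Section Connections.
Context {R : realType} {m n : nat} {M : @manifold R m} {N : @manifold R n}.
Variables (F : M -> N) (D : M -> vec M -> (M -> vec N) -> vec N).
Hypothesis DP : connection_along F D.
Implicit Types (p : M) (v : vec M) (Y Z : M -> vec N).

Lemma conn0 p v : tangent p v -> D p v (fun=> 0) = 0.
Proof.
move=> tv; have := conn_leibniz DP tv (smooth_fun_at_cst 0) (field_along0 F p).
have -> : (fun _ : M => (0 : R) *: (0 : vec N)) = fun=> 0.
  by apply/funext => q; rewrite scale0r.
by rewrite scale0r scaler0 add0r.
Qed.

Lemma connN p v Y : tangent p v -> field_along_at F p Y ->
  D p v (fun q => - Y q) = - D p v Y.
Proof.
move=> tv fY; have := conn_leibniz DP tv (smooth_fun_at_cst (-1)) fY.
have -> : (fun q => -1 *: Y q) = (fun q => - Y q).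
  by apply/funext => q; rewrite scaleN1r.
by rewrite (tangent_cst _ tv) scale0r add0r scaleN1r.
Qed.

Lemma connB p v Y Z : tangent p v -> field_along_at F p Y ->
  field_along_at F p Z -> D p v (fun q => Y q - Z q) = D p v Y - D p v Z.
Proof.
by move=> tv fY fZ; rewrite (conn_additive DP) ?connN //; exact: field_alongN.
Qed.

Lemma conn_sum p v k (Y : 'I_k -> M -> vec N) : tangent p v ->
  (forall j, field_along_at F p (Y j)) ->
  D p v (fun q => \sum_j Y j q) = \sum_j D p v (Y j).
Proof.
move=> tv; elim: k Y => [|k IH] Y fY.
  rewrite big_ord0; apply: etrans (conn0 tv); congr (D p v).
  by apply/funext => q; rewrite big_ord0.
rewrite big_ord_recl -IH // -(conn_additive DP) //; last exact: field_along_sum.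
by congr (D p v); apply/funext => q; rewrite big_ord_recl.
Qed.

(* The indicator function of the set where Y and Z differ is locally constant
   near p, so the Leibniz rule applies to it. *)
Lemma conn_local p v Y Z : tangent p v -> field_along_at F p Y ->
  (\forall q \near p, Y q = Z q) -> D p v Y = D p v Z.
Proof.
move=> tv fY YZ; have fZ := field_along_ext YZ fY; have fW := field_alongB fY fZ.
pose chi q : R := if `[< Y q = Z q >] then 0 else 1.
have schi : smooth_fun_at p chi.
  apply: (@smooth_fun_at_ext _ _ _ _ (fun=> 0)); last exact: smooth_fun_at_cst.
  by apply: filterS YZ => q YZq; rewrite /chi asboolT.
have chi0 : chi p = 0 by rewrite /chi asboolT //; exact: (nbhs_singleton YZ).
have := conn_leibniz DP tv schi fW; rewrite /= chi0.
rewrite (nbhs_singleton YZ) subrr scaler0 scale0r addr0.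
have -> : (fun q => chi q *: (Y q - Z q)) = (fun q => Y q - Z q).
  apply/funext => q; rewrite /chi; case: asboolP => [->|]; last by rewrite scale1r.
  by rewrite scale0r subrr.
by rewrite connB // => /eqP; rewrite subr_eq0 => /eqP.
Qed.

End Connections.

Section AlmostContact.
Context {R : realType} {m : nat} {M : @manifold R m}.
Variables (phi : M -> vec M -> vec M) (xi : M -> vec M) (eta : M -> vec M -> R)
  (g : M -> vec M -> vec M -> R).
Hypothesis acM : almost_contact_metric phi xi eta g.
Implicit Types (p : M) (u v : vec M).

Let gP : riemannian_metric g := ac_metric acM.

Lemma tangent_phi p v : tangent p v -> tangent p (phi p v).
Proof. exact: (ac_phi_tangent acM). Qed.

Lemma tangent_xi p : tangent p (xi p).
Proof. by have /field_along_tangent := ac_xi acM p. Qed.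
Local Hint Resolve tangent_phi tangent_xi tangent_scale tangent_opp : core.

(** Compatibility is applied to u and phi v: phi^2 v = - v + eta(v) xi, and phi u is orthogonal to
    xi. *)
Lemma phi_skew p u v : tangent p u -> tangent p v ->
  g p (phi p u) v = - g p u (phi p v).
Proof.
move=> tu tv; have := ac_compat acM tu (tangent_phi tv).
rewrite (ac_eta_phi acM) // mulr0 subr0 (ac_phi2 acM) //.
rewrite (metricDr gP) ?(metricNr gP) ?(metricZr gP) //; auto.
rewrite -(ac_eta_g acM (tangent_phi tu)) (ac_eta_phi acM tu) mulr0 addr0 => <-.
by rewrite opprK.
Qed.

Lemma phiB p u v : tangent p u -> tangent p v ->
  phi p (u - v) = phi p u - phi p v.
Proof. by move=> tu tv; exact: (linear_onB (@ac_phi_linear _ _ _ _ _ _ _ acM p)). Qed.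

Lemma phiD p u v : tangent p u -> tangent p v ->
  phi p (u + v) = phi p u + phi p v.
Proof. by move=> tu tv; exact: (linear_onD (@ac_phi_linear _ _ _ _ _ _ _ acM p)). Qed.

End AlmostContact.

(** * Cosymplectic structures: [phi] and [xi] are parallel *)

Section Cosymplectic.
Context {R : realType} {m : nat} {M : @manifold R m}.
Variables (phi : M -> vec M -> vec M) (xi : M -> vec M) (eta : M -> vec M -> R)
  (g : M -> vec M -> vec M -> R) (nabla : M -> vec M -> (M -> vec M) -> vec M).
Hypotheses (cosM : cosymplectic phi xi eta g) (lcM : levi_civita g nabla).
Implicit Types (p : M) (u v w : vec M) (X Y Z W : M -> vec M).

Let acM : almost_contact_metric phi xi eta g := cos_acm cosM.
Let gP : riemannian_metric g := ac_metric acM.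
Let conM : connection_along idfun nabla := lc_conn lcM.

Let phiF X : M -> vec M := fun q => phi q (X q).
Let nab X Y : M -> vec M := fun q => nabla q (X q) Y.
(** [dphi X Y] is (nabla_X phi) Y, [t X Y Z] is its product with Z, and [h X Y] is (nabla_X eta)(Y),
    as [hE] shows. *)
Let dphi X Y : M -> vec M := fun q => nab X (phiF Y) q - phi q (nab X Y q).
Let t X Y Z p : R := g p (dphi X Y p) (Z p).
Let h X Y p : R := g p (Y p) (nab X xi p).

Lemma vf_tangent X p : vector_field X -> tangent p (X p).
Proof. by move=> /(_ p) /field_along_tangent. Qed.

Lemma vf_phi X : vector_field X -> vector_field (phiF X).
Proof. by move=> vX p; exact: (ac_phi_smooth acM (vX p)). Qed.

Lemma vf_nab X Y : vector_field X -> vector_field Y -> vector_field (nab X Y).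
Proof. by move=> vX vY p; exact: (conn_smooth conM (vX p) (vY p)). Qed.

Lemma vf_xi : vector_field xi. Proof. exact: ac_xi acM. Qed.

Lemma vf_sub X Y : vector_field X -> vector_field Y ->
  vector_field (fun q => X q - Y q).
Proof. by move=> vX vY p; exact: (field_alongB (vX p) (vY p)). Qed.

Lemma vf_dphi X Y : vector_field X -> vector_field Y -> vector_field (dphi X Y).
Proof.
by move=> vX vY; apply: vf_sub; [|apply: vf_phi]; apply: vf_nab => //; exact: vf_phi.
Qed.

Local Hint Resolve vf_tangent vf_phi vf_nab vf_xi vf_dphi : core.
Local Hint Resolve tangent_add tangent_sub tangent_opp tangent_scale : core.

Let tangent_phi_core p v : tangent p v -> tangent p (phi p v) :=
  @tangent_phi _ _ _ _ _ _ _ acM p v.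
Let tangent_xi_core p : tangent p (xi p) := tangent_xi acM p.
Local Hint Resolve tangent_phi_core tangent_xi_core : core.

Lemma nab_metric X Y Z p : vector_field X -> vector_field Y -> vector_field Z ->
  X p (fun q => g q (Y q) (Z q)) = g p (nab X Y p) (Z p) + g p (Y p) (nab X Z p).
Proof. by move=> vX vY vZ; exact: (lc_metric lcM (vf_tangent p vX) (vY p) (vZ p)). Qed.

Lemma nab_phi X Y p : nab X (phiF Y) p = dphi X Y p + phi p (nab X Y p).
Proof. by rewrite /dphi subrK. Qed.

Lemma bracketE X Y p : vector_field X -> vector_field Y ->
  bracket X Y p = nab X Y p - nab Y X p.
Proof. by move=> vX vY; rewrite (lc_torsion_free lcM (vX p) (vY p)). Qed.

(** Differentiate g(phi Y, Z) = - g(Y, phi Z) along X: nabla_X phi is skew because phi is. *)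
Lemma t_skew X Y Z p : vector_field X -> vector_field Y -> vector_field Z ->
  t X Y Z p = - t X Z Y p.
Proof.
move=> vX vY vZ.
have E : X p (fun q => g q (phiF Y q) (Z q)) = - X p (fun q => g q (Y q) (phiF Z q)).
  have tX := vf_tangent p vX.
  have sYZ : smooth_fun_at p (fun q => g q (Y q) (phiF Z q)).
    by apply: (metric_smooth gP (vY p)); exact: (vf_phi vZ).
  have := tangentM tX (smooth_fun_at_cst (-1)) sYZ.
  rewrite (tangent_cst _ tX) mulr0 addr0 mulN1r => <-.
  congr (X p); apply/funext => q.
  by rewrite mulN1r -(phi_skew acM) //; auto.
move: E; rewrite !nab_metric //; auto.
rewrite !nab_phi (metricDl gP) //; auto.
rewrite (metricDr gP (vf_tangent p (vf_dphi vX vZ))) //; auto.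
rewrite [g p (phi p (nab X Y p)) _](phi_skew acM) //; auto.
rewrite [g p (phiF Y p) _](phi_skew acM) //; auto.
rewrite [g p (Y p) (dphi X Z p)](Defs.metric_sym gP) //; auto.
rewrite /t /phiF; lra.
Qed.

Lemma hE X Y p : vector_field X -> vector_field Y ->
  X p (fun q => eta q (Y q)) = eta p (nab X Y p) + h X Y p.
Proof.
move=> vX vY; rewrite (ac_eta_g acM) //; auto.
rewrite -nab_metric //; auto.
by congr (X p); apply/funext => q; rewrite (ac_eta_g acM) //; auto.
Qed.

(** Covariant derivative of phi^2 = - I + eta (x) xi along X. *)
Lemma dphi_phi X Y p : vector_field X -> vector_field Y ->
  dphi X (phiF Y) p =
  - phi p (dphi X Y p) + h X Y p *: xi p + eta p (Y p) *: nab X xi p.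
Proof.
move=> vX vY; rewrite {1}/dphi [nab X (phiF Y) p]nab_phi (phiD acM) //; auto.
rewrite (ac_phi2 acM) //; auto.
have -> : nab X (phiF (phiF Y)) p = - nab X Y p +
    ((eta p (nab X Y p) + h X Y p) *: xi p + eta p (Y p) *: nab X xi p).
  rewrite -hE // -(conn_leibniz conM) //; auto; last 2 first.
  - exact: (ac_eta_smooth acM (vY p)).
  - exact: vf_xi.
  rewrite -(connN conM) //; auto; last exact: vY.
  rewrite -(conn_additive conM) //; auto; last 2 first.
  - exact: (field_alongN (vY p)).
  - exact: (field_alongZ (ac_eta_smooth acM (vY p)) (vf_xi p)).
  congr (nabla p (X p)); apply/funext => q.
  by rewrite /phiF (ac_phi2 acM) //; auto.
apply/funext => f; rewrite !(vecDE, vecNE, vecZE); ring.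
Qed.

Lemma t_phi X Y Z p : vector_field X -> vector_field Y -> vector_field Z ->
  t X (phiF Y) Z p =
  t X Y (phiF Z) p + h X Y p * eta p (Z p) + eta p (Y p) * h X Z p.
Proof.
move=> vX vY vZ; rewrite /t dphi_phi // /h.
move: (vf_tangent p (vf_dphi vX vY)) (vf_tangent p vZ) (vf_tangent p (vf_nab vX vf_xi)).
rewrite /phiF; move: (dphi X Y p) (Z p) (nab X xi p) => u z w tu tz tw.
rewrite !(metricDl gP) ?(metricZl gP) ?(metricNl gP) //; auto.
rewrite (phi_skew acM) // opprK (ac_eta_g acM tz) [g p (xi p) _](Defs.metric_sym gP) //.
by rewrite [g p w z](Defs.metric_sym gP).
Qed.

(** From phi xi = 0 one gets (nabla_X phi) xi = - phi (nabla_X xi); skewness of nabla_X phi and of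
    phi does the rest. *)
Lemma t_xi X Y p : vector_field X -> vector_field Y ->
  t X Y xi p = - h X (phiF Y) p.
Proof.
move=> vX vY; rewrite t_skew // /t /dphi; auto.
have -> : nab X (phiF xi) p = 0.
  rewrite -(conn0 conM (vf_tangent p vX)) /nab; congr (nabla p (X p)).
  by apply/funext => q; rewrite /phiF (ac_phi_xi acM).
rewrite sub0r (metricNl gP) ?(phi_skew acM) //; auto.
by rewrite (Defs.metric_sym gP) //; auto; rewrite /h /phiF !opprK.
Qed.

Lemma t_phi_phi X Y Z p : vector_field X -> vector_field Y -> vector_field Z ->
  t X Y (phiF (phiF Z)) p = - t X Y Z p + eta p (Z p) * t X Y xi p.
Proof.
move=> vX vY vZ; rewrite /t /phiF (ac_phi2 acM) //; auto.
by rewrite (metricDr gP) ?(metricNr gP) ?(metricZr gP) //; auto.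
Qed.

(** Without torsion, d eta (X, Y) = (nabla_X eta)(Y) - (nabla_Y eta)(X). *)
Lemma h_sym X Y p : vector_field X -> vector_field Y -> h X Y p = h Y X p.
Proof.
move=> vX vY; have := cos_eta_closed cosM (vX p) (vY p).
rewrite /d_eta !hE // bracketE //.
rewrite !(ac_eta_g acM) ?(metricBl gP) //; auto.
lra.
Qed.

(** Without torsion, d Phi is the cyclic sum of nabla Phi, and (nabla_X Phi)(Y, Z) = - t X Y Z. *)
Lemma d_PhiE X Y Z p : vector_field X -> vector_field Y -> vector_field Z ->
  t X Y Z p + t Y Z X p + t Z X Y p = 0.
Proof.
move=> vX vY vZ; have := cos_Phi_closed cosM (vX p) (vY p) (vZ p).
have PhiE A B C : vector_field A -> vector_field B -> vector_field C ->
    A p (fun q => Phi phi g q (B q) (C q)) =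
    g p (nab A B p) (phi p (C p)) - g p (nab A C p) (phi p (B p)) - t A B C p.
  move=> vA vB vC; rewrite (nab_metric p vA vB (vf_phi vC)) nab_phi.
  rewrite (metricDr gP) //; auto.
  rewrite -[g p (B p) (phi p _)]opprK -(phi_skew acM) //; auto.
  rewrite [g p (phi p _) _](Defs.metric_sym gP) //; auto.
  rewrite [g p _ (dphi A C p)](Defs.metric_sym gP) //; auto.
  rewrite (t_skew p vA vB vC) /t; lra.
rewrite /d_Phi !PhiE // !bracketE // /Phi !(metricBl gP) //; auto.
lra.
Qed.

(** As eta is closed, normality reduces to [phi, phi] = 0. Once brackets are written with nabla, all
    terms that do not involve nabla phi cancel. *)
Lemma nijenhuisE Y Z p : vector_field Y -> vector_field Z ->
  dphi (phiF Y) Z p - dphi (phiF Z) Y p + phi p (dphi Z Y p)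
  - phi p (dphi Y Z p) = 0.
Proof.
move=> vY vZ; have := cos_normal cosM (vY p) (vZ p).
rewrite (cos_eta_closed cosM) // scale0r addr0 => <-.
have vpY := vf_phi vY; have vpZ := vf_phi vZ.
rewrite /nijenhuis (bracketE p vY vZ) (bracketE p vpY vpZ) (bracketE p vpY vZ).
rewrite (bracketE p vY vpZ) !(phiB acM) //; auto.
rewrite !nab_phi !(phiD acM) //; auto.
apply/funext => f; rewrite !(vecDE, vecNE, vecZE); ring.
Qed.

(* When d eta = 0, one has 2 g((nabla_X phi) Y, Z) = d Phi(X, phi Y, phi Z)
   - d Phi(X, Y, Z) + g([phi, phi](Y, Z), phi X). *)
Lemma cosymplectic_t0 X Y Z p : vector_field X -> vector_field Y ->
  vector_field Z -> t X Y Z p = 0.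
Proof.
move=> vX vY vZ.
have vpX := vf_phi vX; have vpY := vf_phi vY; have vpZ := vf_phi vZ.
have dPhi := d_PhiE p vX vpY vpZ.
have dPhi' := d_PhiE p vX vY vZ.
have compat u : tangent p u ->
    g p (phi p u) (phi p (X p)) = g p u (X p) - g p u (xi p) * eta p (X p).
  by move=> tu; rewrite (ac_compat acM) // ?(ac_eta_g acM tu) //; auto.
(* This is [nijenhuisE] paired with phi X; [compat] removes the outer phi of its last two terms. *)
have nij : t (phiF Y) Z (phiF X) p - t (phiF Z) Y (phiF X) p + (t Z Y X p -
    t Z Y xi p * eta p (X p)) - (t Y Z X p - t Y Z xi p * eta p (X p)) = 0.
  have := congr1 (fun v => g p v (phi p (X p))) (nijenhuisE p vY vZ).
  rewrite /= (metric0l gP) //; auto.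
  rewrite /t; move: (vf_tangent p (vf_dphi vpY vZ)) (vf_tangent p (vf_dphi vpZ vY)).
  move: (vf_tangent p (vf_dphi vZ vY)) (vf_tangent p (vf_dphi vY vZ)).
  move: (dphi (phiF Y) Z p) (dphi (phiF Z) Y p) (dphi Z Y p) (dphi Y Z p).
  move=> a b c d tc td ta tb.
  by rewrite !(metricBl gP, metricDl gP) ?compat //; auto 6.
(* These relations move phi between arguments. By symmetry of [h], the terms in eta(Y) and eta(Z)
   cancel within [dPhi], and those in eta(X) cancel against [nij]. What remains is - t X Y Z + t Y Z
   X + t Z X Y = 0, which together with [dPhi'] gives 2 t X Y Z = 0. *)
have e1 := t_phi p vX vY vpZ; have e2 := t_phi_phi p vX vY vZ.
have e3 := t_phi p vpY vZ vX; have e4 := t_phi p vpZ vY vX.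
have e5 := t_skew p vpZ vX vpY; have e6 := t_skew p vZ vX vY.
have etaphi : eta p (phiF Z p) = 0 by rewrite (ac_eta_phi acM) //; auto.
move: nij dPhi e1 e2 e3 e4; rewrite etaphi !t_xi //.
rewrite [h (phiF Y) Z p]h_sym // [h (phiF Z) Y p]h_sym //.
rewrite [h (phiF Y) X p]h_sym // [h (phiF Z) X p]h_sym //.
lra.
Qed.

(** The form [t X Y] is tested on the global field [dphi X Y] itself. *)
Lemma nabla_phi X Y p : vector_field X -> vector_field Y ->
  nabla p (X p) (fun q => phi q (Y q)) = phi p (nabla p (X p) Y).
Proof.
move=> vX vY; apply/eqP; rewrite -subr_eq0; apply/eqP.
apply: (metric_eq0 gP (vf_tangent p (vf_dphi vX vY))).
exact: (cosymplectic_t0 p vX vY (vf_dphi vX vY)).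
Qed.

(** As phi is parallel, phi (nabla_X xi) = nabla_X (phi xi) = 0, so nabla_X xi is a multiple of xi;
    as xi has length 1, it is also orthogonal to xi. *)
Lemma nabla_xi X p : vector_field X -> nabla p (X p) xi = 0.
Proof.
move=> vX; have tX := vf_tangent p vX.
have tn : tangent p (nab X xi p) by auto.
have : phi p (nab X xi p) = 0.
  rewrite -(nabla_phi p vX vf_xi) -(conn0 conM tX); congr (nabla p (X p)).
  by apply/funext => q; rewrite (ac_phi_xi acM).
move=> /(congr1 (phi p)).
rewrite (ac_phi2 acM) // (linear_on0 (@ac_phi_linear _ _ _ _ _ _ _ acM p)).
suff -> : eta p (nab X xi p) = 0.
  by rewrite scale0r addr0 => /eqP; rewrite oppr_eq0 => /eqP.
have := nab_metric p vX vf_xi vf_xi.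
have -> : (fun q => g q (xi q) (xi q)) = fun=> 1.
  by apply/funext => q; rewrite -(ac_eta_g acM) ?(ac_eta_xi acM) //; auto.
rewrite (tangent_cst _ tX) (Defs.metric_sym gP (tangent_xi acM p) tn) -(ac_eta_g acM tn).
lra.
Qed.

End Cosymplectic.

(** * The pullback connection *)

Section PullbackConnection.
Context {R : realType} {m n : nat} {M : @manifold R m} {N : @manifold R n}.
Variables (gN : N -> vec N -> vec N -> R) (F : M -> N)
  (nablaN : N -> vec N -> (N -> vec N) -> vec N)
  (nablaF : M -> vec M -> (M -> vec N) -> vec N).
Hypotheses (gNP : riemannian_metric gN) (lcN : levi_civita gN nablaN)
  (sF : smooth_map F) (pcF : pullback_connection F nablaN nablaF).
Implicit Types (p : M) (v : vec M) (X Y : M -> vec M) (A B : M -> vec N).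

Let conF : connection_along F nablaF := pullback_conn pcF.
Let conN : connection_along idfun nablaN := lc_conn lcN.

Section Frame.
Variables (p : M) (d : @chart R n N).
Hypotheses (ad : atlas d) (dp : chart_dom d (F p)).

Let tE j : tangent (F p) (coord_vec d j (F p)).
Proof. exact: tangent_coord_vec. Qed.

Let fE j : field_at (F p) (coord_vec d j).
Proof. exact: field_coord_vec. Qed.

Let fEF j : field_along_at F p (coord_vec d j \o F).
Proof. exact: field_along_comp. Qed.

(** It suffices to test on coordinate functions, whose derivatives along coordinate fields are
    constant near the point. Tangency of the bracket, needed for this test, is read off from the
    torsion-free connection. *)
Lemma bracket_coord_vec i j :
  bracket (coord_vec d i) (coord_vec d j) (F p) = 0.
Proof.
have tb : tangent (F p) (bracket (coord_vec d i) (coord_vec d j) (F p)).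
  rewrite -(lc_torsion_free lcN) //.
  by apply: tangent_sub; exact: (conn_tangent conN (tE _) (fE _)).
apply: (tangent_eq tb (tangent0 _) ad dp) => k.
rewrite /bracket on_smoothE; last exact: smooth_fun_at_coord.
have E a b : coord_vec d a (F p) (fun y => coord_vec d b y (fun z => d z 0 k)) = 0.
  rewrite -(tangent_cst (b == k)%:R (tE a)); apply: tangent_ext => //.
  by apply: filterS (near_dom dp) => y dy; exact: coord_vec_coord.
by rewrite !E subrr.
Qed.

Lemma conn_coord_vec_sym i j :
  nablaN (F p) (coord_vec d i (F p)) (coord_vec d j) =
  nablaN (F p) (coord_vec d j (F p)) (coord_vec d i).
Proof.
by apply/eqP; rewrite -subr_eq0 (lc_torsion_free lcN) // bracket_coord_vec.
Qed.

(** By locality, [A] may be replaced by its expansion in the fields [coord_vec d j \o F]; these come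
    from the target, so [pullback_comp] prescribes their derivatives. *)
Lemma pullback_conn_frame v A : tangent p v -> field_along_at F p A ->
  nablaF p v A = \sum_j (v (fun q => A q (fun y => d y 0 j)) *: coord_vec d j (F p)
    + A p (fun y => d y 0 j) *:
      nablaN (F p) (differential F p v) (coord_vec d j)).
Proof.
move=> tv fA; have sA j := fA.2 _ (smooth_fun_at_coord j ad dp).
have fAE j := field_alongZ (sA j) (fEF j).
rewrite (conn_local conF tv fA (field_along_coord sF fA ad dp)).
rewrite (conn_sum conF tv fAE); apply: eq_bigr => j _.
by rewrite (conn_leibniz conF tv (sA j) (fEF j)) (pullback_comp pcF tv (fE j)).
Qed.

(** The Christoffel terms of the two expansions agree after exchanging the summation indices, by
    [conn_coord_vec_sym], so only the second derivatives of the coordinates of [F] remain. *)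
Lemma pullback_torsion_frame X Y : field_at p X -> field_at p Y ->
  nablaF p (X p) (fun q => differential F q (Y q))
  - nablaF p (Y p) (fun q => differential F q (X q))
  = \sum_j (X p (fun q => Y q (fun x => d (F x) 0 j))
      - Y p (fun q => X q (fun x => d (F x) 0 j))) *: coord_vec d j (F p).
Proof.
move=> fX fY; have tX := field_along_tangent fX; have tY := field_along_tangent fY.
have fFX := field_along_differential sF fX.
have fFY := field_along_differential sF fY.
have dE Z q j : chart_dom d (F q) ->
    differential F q (Z q) (fun y => d y 0 j) = Z q (fun x => d (F x) 0 j).
  by move=> dq; rewrite differentialE //; exact: smooth_fun_at_coord.
have expand Z W : field_at p Z -> field_at p W ->
    nablaF p (Z p) (fun q => differential F q (W q)) =
    \sum_j Z p (fun q => W q (fun x => d (F x) 0 j)) *: coord_vec d j (F p) +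
    \sum_j \sum_k (W p (fun x => d (F x) 0 j) * Z p (fun x => d (F x) 0 k)) *:
      nablaN (F p) (coord_vec d k (F p)) (coord_vec d j).
  move=> fZ fW; have tZ := field_along_tangent fZ.
  rewrite (pullback_conn_frame tZ (field_along_differential sF fW)) -big_split /=.
  apply: eq_bigr => j _; congr (_ *: _ + _).
    apply: (tangent_ext tZ).
    by apply: filterS (near_comp sF (near_dom dp)) => q dq; exact: dE.
  rewrite dE // (differential_coord sF tZ ad dp).
  have [_ ->] := linear_on_sum (conn_linear conN (fE j))
    (fun k => Z p (fun x => d (F x) 0 k)) tE.
  by rewrite scaler_sumr; apply: eq_bigr => k _; rewrite scalerA.
rewrite !expand // [X in _ - (_ + X)]exchange_big /=.
set S := \sum_j \sum_k _; set S' := \sum_j \sum_k _.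
have -> : S' = S.
  apply: eq_bigr => j _; apply: eq_bigr => k _.
  by rewrite mulrC conn_coord_vec_sym.
by rewrite opprD addrACA subrr addr0 -sumrB; apply: eq_bigr => j _; rewrite scalerBl.
Qed.

End Frame.

Lemma pullback_torsion X Y p : field_at p X -> field_at p Y ->
  tangent p (bracket X Y p) ->
  nablaF p (X p) (fun q => differential F q (Y q))
  - nablaF p (Y p) (fun q => differential F q (X q))
  = differential F p (bracket X Y p).
Proof.
move=> fX fY tXY; have [d ad dp] := atlas_cover (F p).
rewrite (pullback_torsion_frame ad dp fX fY) (differential_coord sF tXY ad dp).
apply: eq_bigr => j _; rewrite /bracket on_smoothE //.
exact: (smooth_comp sF (smooth_fun_at_coord j ad dp)).
Qed.

Section MetricCompatibility.
Variables (p : M) (v : vec M).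
Hypothesis tv : tangent p v.

(** Smoothness of the product is carried along with the identity: [metric_smooth] speaks of fields
    on the target, not of fields along [F], and the Leibniz rule for [v] requires it. *)
Let compat A B := smooth_fun_at p (fun q => gN (F q) (A q) (B q)) /\
  v (fun q => gN (F q) (A q) (B q)) =
    gN (F p) (nablaF p v A) (B p) + gN (F p) (A p) (nablaF p v B).

Let compat_ext A A' B : field_along_at F p A -> (\forall q \near p, A q = A' q) ->
  compat A B -> compat A' B.
Proof.
move=> fA AA' [sAB E]; split.
  by apply: smooth_fun_at_ext sAB; apply: filterS AA' => q ->.
rewrite -(nbhs_singleton AA') -(conn_local conF tv fA AA') -E.
by apply: (tangent_ext tv); apply: filterS AA' => q ->.
Qed.

Let compat_sym A B : field_along_at F p A -> field_along_at F p B ->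
  compat A B -> compat B A.
Proof.
move=> fA fB [sAB E].
have symAB : \forall q \near p, gN (F q) (A q) (B q) = gN (F q) (B q) (A q).
  by apply: filterS2 fA.1 fB.1 => q tA tB; rewrite (Defs.metric_sym gNP).
split; first exact: smooth_fun_at_ext sAB.
rewrite -(tangent_ext tv symAB) E addrC; congr (_ + _);
  apply: (Defs.metric_sym gNP) => //; try exact: (conn_tangent conF);
  exact: field_along_tangent.
Qed.

Let compat0 B : field_along_at F p B -> compat (fun=> 0) B.
Proof.
move=> fB; have B0 : \forall q \near p, 0 = gN (F q) 0 (B q).
  by apply: filterS fB.1 => q tB; rewrite (metric0l gNP).
split; first by apply: smooth_fun_at_ext B0 _; exact: (smooth_fun_at_cst 0).
rewrite -(tangent_ext tv B0) (tangent_cst _ tv) (conn0 conF tv).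
rewrite !(metric0l gNP) ?addr0 //; first exact: (conn_tangent conF).
exact: field_along_tangent.
Qed.

Let compatD A A' B : field_along_at F p A -> field_along_at F p A' ->
  field_along_at F p B ->
  compat A B -> compat A' B -> compat (fun q => A q + A' q) B.
Proof.
move=> fA fA' fB [s E] [s' E'].
have D : \forall q \near p, gN (F q) (A q) (B q) + gN (F q) (A' q) (B q) =
    gN (F q) (A q + A' q) (B q).
  by apply: filterS3 fA.1 fA'.1 fB.1 => q *; rewrite (metricDl gNP).
split; first by apply: smooth_fun_at_ext D _; exact: smooth_fun_atD.
rewrite -(tangent_ext tv D) (tangentD tv s s') E E' (conn_additive conF) //.
have tA := conn_tangent conF tv fA; have tA' := conn_tangent conF tv fA'.
have tB := conn_tangent conF tv fB.
rewrite !(metricDl gNP) //; try exact: field_along_tangent.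
by rewrite addrACA.
Qed.

Let compatZ a A B : smooth_fun_at p a -> field_along_at F p A ->
  field_along_at F p B -> compat A B -> compat (fun q => a q *: A q) B.
Proof.
move=> sa fA fB [s E].
have D : \forall q \near p, a q * gN (F q) (A q) (B q) = gN (F q) (a q *: A q) (B q).
  by apply: filterS2 fA.1 fB.1 => q *; rewrite (metricZl gNP).
split; first by apply: smooth_fun_at_ext D _; exact: smooth_fun_atM.
rewrite -(tangent_ext tv D) (tangentM tv sa s) E (conn_leibniz conF) //.
have tA := field_along_tangent fA; have tB := field_along_tangent fB.
have tnA := conn_tangent conF tv fA; have tnB := conn_tangent conF tv fB.
rewrite (metricDl gNP) ?(metricZl gNP) //; try exact: tangent_scale.
ring.
Qed.

Let compat_sum k (A : 'I_k -> M -> vec N) B :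
  (forall j, field_along_at F p (A j)) -> field_along_at F p B ->
  (forall j, compat (A j) B) -> compat (fun q => \sum_j A j q) B.
Proof.
elim: k A => [|k IH] A fA fB cA.
  have -> : (fun q => \sum_j A j q) = fun=> 0.
    by apply/funext => q; rewrite big_ord0.
  exact: compat0.
have -> : (fun q => \sum_j A j q) =
    (fun q => A ord0 q + \sum_j A (lift ord0 j) q).
  by apply/funext => q; rewrite big_ord_recl.
apply: compatD => //; first exact: field_along_sum.
exact: IH.
Qed.

Let compat_frame d A B : atlas d -> chart_dom d (F p) ->
  field_along_at F p A -> field_along_at F p B ->
  (forall j, compat (coord_vec d j \o F) B) -> compat A B.
Proof.
move=> ad dp fA fB cB.
have fE j : field_along_at F p (coord_vec d j \o F).
  by apply: (field_along_comp sF); exact: field_coord_vec.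
have sA j := fA.2 _ (smooth_fun_at_coord j ad dp).
have fAE j := field_alongZ (sA j) (fE j).
apply: (compat_ext (field_along_sum fAE)).
  by apply: filterS (field_along_coord sF fA ad dp) => q <-.
by apply: compat_sum => // j; exact: compatZ.
Qed.

(** The identity is stable under sums and multiplication by smooth functions, so both arguments
    reduce to frame fields pulled back from the target, where it is metric compatibility of
    [nablaN]. *)
Lemma pullback_metric A B : field_along_at F p A -> field_along_at F p B ->
  v (fun q => gN (F q) (A q) (B q)) =
    gN (F p) (nablaF p v A) (B p) + gN (F p) (A p) (nablaF p v B).
Proof.
move=> fA fB; have [d ad dp] := atlas_cover (F p).
have fE j : field_at (F p) (coord_vec d j) by exact: field_coord_vec.
have fEF j := field_along_comp sF (fE j).
suff [] : compat A B by [].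
apply: (compat_frame ad dp fA fB) => j; apply: compat_sym => //.
apply: (compat_frame ad dp fB) => // k; split.
  exact: (smooth_comp sF (metric_smooth gNP (fE k) (fE j))).
have sE := metric_smooth gNP (fE k) (fE j).
rewrite !(pullback_comp pcF) //= -(lc_metric lcN) //; last exact: tangent_differential.
by rewrite differentialE.
Qed.

End MetricCompatibility.

End PullbackConnection.

(** * The second fundamental form and slant submersions *)

Section SecondFundamentalForm.
Context {R : realType} {m n : nat} {M : @manifold R m} {N : @manifold R n}.
Variables (gM : M -> vec M -> vec M -> R) (gN : N -> vec N -> vec N -> R)
  (F : M -> N) (nablaM : M -> vec M -> (M -> vec M) -> vec M)
  (nablaN : N -> vec N -> (N -> vec N) -> vec N)
  (nablaF : M -> vec M -> (M -> vec N) -> vec N).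
Hypotheses (gMP : riemannian_metric gM) (gNP : riemannian_metric gN)
  (lcM : levi_civita gM nablaM) (lcN : levi_civita gN nablaN)
  (subF : riemannian_submersion gM gN F)
  (pcF : pullback_connection F nablaN nablaF).
Implicit Types (p : M) (u v : vec M) (X Y Z : M -> vec M).

Let sF : smooth_map F := rs_smooth subF.
Let conM : connection_along idfun nablaM := lc_conn lcM.
Let conF : connection_along F nablaF := pullback_conn pcF.
Let S X Y p : vec N := second_fundamental_form F nablaM nablaF X Y p.

Lemma sff_sym X Y p : field_at p X -> field_at p Y -> S X Y p = S Y X p.
Proof.
move=> fX fY; have tX := field_along_tangent fX; have tY := field_along_tangent fY.
have tXY := conn_tangent conM tX fY; have tYX := conn_tangent conM tY fX.
have tb : tangent p (bracket X Y p).
  by rewrite -(lc_torsion_free lcM) //; exact: tangent_sub.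
have := pullback_torsion lcN sF pcF fX fY tb.
rewrite -(lc_torsion_free lcM fX fY) differentialB.
move=> /eqP; rewrite subr_eq => /eqP E.
rewrite /S /second_fundamental_form E.
by apply/funext => f; rewrite !(vecDE, vecNE); ring.
Qed.

Lemma sffDr X Y Z p : field_at p X -> vector_field Y -> vector_field Z ->
  S X (fun q => Y q + Z q) p = S X Y p + S X Z p.
Proof.
move=> fX vY vZ; have tX := field_along_tangent fX.
have dY := field_along_differential sF (vY p).
have dZ := field_along_differential sF (vZ p).
rewrite /S /second_fundamental_form (conn_additive conM tX (vY p) (vZ p)).
have -> : (fun q => differential F q (Y q + Z q)) =
    (fun q => differential F q (Y q) + differential F q (Z q)).
  by apply/funext => q; rewrite differentialD.
rewrite (conn_additive conF tX dY dZ) differentialD.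
by apply/funext => f; rewrite !(vecDE, vecNE); ring.
Qed.

(** Polarization of [rs_length], through u + v. *)
Lemma horizontal_isometry p u v : horizontal gM F p u -> horizontal gM F p v ->
  gN (F p) (differential F p u) (differential F p v) = gM p u v.
Proof.
move=> hu hv; have huv := horizontal_linear gMP 1 hu hv.
have := rs_length subF huv; have := rs_length subF hu; have := rs_length subF hv.
rewrite scale1r differentialD; move: hu hv => [tu _] [tv _].
have tdu := tangent_differential sF tu; have tdv := tangent_differential sF tv.
rewrite !(metricDl gNP, metricDr gNP, metricDl gMP, metricDr gMP) //;
  try exact: tangent_add.
rewrite (Defs.metric_sym gNP tdv tdu) (Defs.metric_sym gMP tv tu); lra.
Qed.

Lemma tangent_extension p v : tangent p v -> exists2 X, field_at p X & X p = v.
Proof.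
move=> tv; have [c ac cp] := atlas_cover p.
exists (fun q => \sum_j v (fun x => c x 0 j) *: coord_vec c j q).
  apply: field_along_sum => j; apply: field_alongZ; first exact: smooth_fun_at_cst.
  exact: field_coord_vec.
by rewrite -(tangent_coord tv ac cp).
Qed.

(** Horizontality near [p] is enough here, and a given vector extends to such a field without a
    cutoff function: extend with constant coefficients in a chart, then project. *)
Let hfield p X := field_at p X /\ \forall q \near p, horizontal gM F q (X q).

(** Near [p] the functions gN(F_* Y, F_* Z) and gM(Y, Z) coincide; their derivatives along X,
    expanded by [pullback_metric] and [lc_metric], are compared. *)
Lemma sff_skew X Y Z p : hfield p X -> hfield p Y -> hfield p Z ->
  gN (F p) (S X Y p) (differential F p (Z p)) =
  - gN (F p) (S X Z p) (differential F p (Y p)).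
Proof.
move=> [fX _] [fY hY] [fZ hZ].
have tX := field_along_tangent fX.
have dY := field_along_differential sF fY.
have dZ := field_along_differential sF fZ.
have tdY := field_along_tangent dY; have tdZ := field_along_tangent dZ.
have tnY := conn_tangent conM tX fY; have tnZ := conn_tangent conM tX fZ.
have tFY := conn_tangent conF tX dY; have tFZ := conn_tangent conF tX dZ.
have E : X p (fun q => gN (F q) (differential F q (Y q)) (differential F q (Z q))) =
    X p (fun q => gM q (Y q) (Z q)).
  by apply: (tangent_ext tX); apply: filterS2 hY hZ => q; exact: horizontal_isometry.
have dH u W : tangent p u -> horizontal gM F p (W p) ->
    gN (F p) (differential F p u) (differential F p (W p)) = gM p u (W p).
  move=> tu hW; have hu := horizontal_Hproj gMP subF tu.
  rewrite -(metric_Hproj gMP subF tu hW) -horizontal_isometry //.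
  congr (gN _ _ _); rewrite -[in LHS](VHprojK gM F p u) differentialD.
  by have [_ ->] := vertical_Vproj gMP subF tu; rewrite add0r.
move: E; rewrite (pullback_metric gNP lcN sF pcF tX dY dZ) (lc_metric lcM tX fY fZ).
rewrite /S /second_fundamental_form !(metricBl gNP) //;
  try exact: (tangent_differential sF).
rewrite !dH //; try exact: (nbhs_singleton hY); try exact: (nbhs_singleton hZ).
rewrite (Defs.metric_sym gNP tdY tFZ).
rewrite (Defs.metric_sym gMP (field_along_tangent fY) tnZ); lra.
Qed.

(* A trilinear form that is symmetric in its first two arguments and
   skew-symmetric in its last two vanishes. *)
Lemma sff_horizontal X Y p : hfield p X -> hfield p Y -> S X Y p = 0.
Proof.
move=> hX hY; have [fX _] := hX; have [fY _] := hY.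
have tS : tangent (F p) (S X Y p).
  have tX := field_along_tangent fX.
  apply: tangent_sub; first exact: (conn_tangent conF tX (field_along_differential sF fY)).
  exact: (tangent_differential sF (conn_tangent conM tX fY)).
(* By maximal rank the value S X Y p is itself F_* of a horizontal vector, which is taken as the
   third argument; the trilinear form then computes its square length. *)
have [v tv vS] := rs_max_rank subF tS.
have [W fW Wv] := tangent_extension tv.
pose Z q := Hproj gM F q (W q).
have hZ : hfield p Z.
  split; first exact: (field_Hproj gMP subF).
  by apply: filterS fW.1 => q; exact: (horizontal_Hproj gMP subF).
have ZS : differential F p (Z p) = S X Y p.
  rewrite -vS -Wv -[in RHS](VHprojK gM F p (W p)) differentialD.
  have [_ ->] := vertical_Vproj gMP subF (field_along_tangent fW).
  by rewrite add0r.
apply: (metric_eq0 gNP tS); rewrite -{2}ZS.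
have [fZ _] := hZ.
have e1 := sff_skew hX hY hZ; have e2 := sff_skew hZ hX hY.
have e3 := sff_skew hY hZ hX.
rewrite (sff_sym fX fZ) in e1; rewrite (sff_sym fZ fY) in e2.
rewrite (sff_sym fY fX) in e3; lra.
Qed.

Lemma sff_vertical E V p : vector_field E -> vertical_field F V ->
  S E V p = - differential F p (nablaM p (E p) V).
Proof.
move=> vE [_ V0]; rewrite /S /second_fundamental_form.
have -> : (fun q => differential F q (V q)) = fun=> 0.
  by apply/funext => q; have [] := V0 q.
by rewrite (conn0 conF) ?sub0r //; exact: (field_along_tangent (vE p)).
Qed.

(** On a vertical second argument the form is - F_* (nabla_E V), which vanishes exactly when nabla_E
    V is orthogonal to all horizontal vectors. *)
Lemma totally_geodesicP : totally_geodesic F nablaM nablaF <->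
  forall U V X Z, vertical_field F U -> vertical_field F V ->
    horizontal_field gM F X -> horizontal_field gM F Z -> forall p,
    gM p (nablaM p (U p) V) (X p) = 0 /\ gM p (nablaM p (Z p) U) (X p) = 0.
Proof.
split=> [tg U V X Z vU vV hX hZ p|H X Y vX vY p].
  have E0 E W : vector_field E -> vertical_field F W ->
      gM p (nablaM p (E p) W) (X p) = 0.
    move=> vE vW; apply: (metric_vert_hor gMP _ (hX.2 p)); split.
      exact: (conn_tangent conM (field_along_tangent (vE p)) (vW.1 p)).
    have := tg E W vE vW.1 p; rewrite -/(S E W p) sff_vertical // => /eqP.
    by rewrite oppr_eq0 => /eqP.
  by split; apply: E0 => //; [exact: vU.1|exact: hZ.1].
have projV E : vector_field E -> vertical_field F (fun q => Vproj gM F q (E q)).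
  move=> vE; split=> q; first exact: (field_Vproj gMP subF (vE q)).
  exact: (vertical_Vproj gMP subF (field_along_tangent (vE q))).
have projH E : vector_field E -> horizontal_field gM F (fun q => Hproj gM F q (E q)).
  move=> vE; split=> q; first exact: (field_Hproj gMP subF (vE q)).
  exact: (horizontal_Hproj gMP subF (field_along_tangent (vE q))).
have S0 E V : vector_field E -> vertical_field F V ->
    (forall W, horizontal_field gM F W -> gM p (nablaM p (E p) V) (W p) = 0) ->
    S E V p = 0.
  move=> vE vV gE; rewrite sff_vertical //.
  have vn : vector_field (fun q => nablaM q (E q) V).
    by move=> q; exact: (conn_smooth conM (vE q) (vV.1 q)).
  have tn := field_along_tangent (vn p).
  (* The test field is the horizontal part of nabla_E V. *)
  have := gE _ (projH _ vn).
  rewrite -(metric_Hproj gMP subF tn (horizontal_Hproj gMP subF tn)).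
  move=> /(metric_eq0 gMP (tangent_Hproj gMP subF tn)) Hn.
  rewrite -(VHprojK gM F p (nablaM p (E p) V)) Hn addr0.
  by have [_ ->] := vertical_Vproj gMP subF tn; rewrite oppr0.
have := projV _ vX; have := projV _ vY; have := projH _ vX; have := projH _ vY.
set HY := (fun q => Hproj gM F q (Y q)); set HX := (fun q => Hproj gM F q (X q)).
set VY := (fun q => Vproj gM F q (Y q)); set VX := (fun q => Vproj gM F q (X q)).
move=> hHY hHX vVY vVX.
have YE : Y = (fun q => VY q + HY q).
  by apply/funext => q; rewrite /VY /HY VHprojK.
have XE : X = (fun q => VX q + HX q).
  by apply/funext => q; rewrite /VX /HX VHprojK.
clearbody HY HX VY VX.
rewrite -/(S X Y p) {1}YE sffDr //; [|exact: vVY.1|exact: hHY.1].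
(* Swapping the arguments lets additivity in the second one split X as well. Of the four terms, the
   purely horizontal one vanishes, and the others are arranged with a vertical field second, as [S0]
   requires. *)
rewrite !(sff_sym (vX p)); [|exact: (hHY.1 p)|exact: (vVY.1 p)].
rewrite XE !sffDr //; try exact: vVX.1; try exact: hHX.1; try exact: (hHY.1 p);
  try exact: (vVY.1 p).
rewrite [S VY HX p]sff_sym; [|exact: (vVY.1 p)|exact: (hHX.1 p)].
have -> : S HY HX p = 0.
  apply: sff_horizontal; split; [exact: (hHY.1 p)| |exact: (hHX.1 p)|].
    by near=> q; exact: hHY.2.
  by near=> q; exact: hHX.2.
rewrite !S0 ?addr0 //; try exact: vVY.1; try exact: hHX.1; try exact: hHY.1.
- by move=> W hW; have [_] := H VX VX W HY vVX vVX hW hHY p.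
- by move=> W hW; have [_] := H VY VY W HX vVY vVY hW hHX p.
- by move=> W hW; have [] := H VY VX W W vVY vVX hW hW p.
Unshelve. all: by end_near. Qed.

End SecondFundamentalForm.

(** * The slant condition as a formula for psi^2 *)

Section SlantSubmersion.
Context {R : realType} {m n : nat} {M : @manifold R m} {N : @manifold R n}.
Variables (phi : M -> vec M -> vec M) (xi : M -> vec M) (eta : M -> vec M -> R)
  (gM : M -> vec M -> vec M -> R) (gN : N -> vec N -> vec N -> R)
  (F : M -> N) (theta : R).
Hypotheses (acM : almost_contact_metric phi xi eta gM)
  (subF : riemannian_submersion gM gN F)
  (slantF : slant gM F phi xi theta) (theta_neq0 : theta <> 0)
  (xi_vert : forall p, vertical F p (xi p)).
Implicit Types (p : M) (u v : vec M).

Let gMP : riemannian_metric gM := ac_metric acM.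
Let psiF := psi gM F phi.

Let txi p : tangent p (xi p). Proof. exact: (xi_vert p).1. Qed.

Let tphi p v : tangent p v -> tangent p (phi p v).
Proof. exact: (ac_phi_tangent acM). Qed.

Lemma Vproj_linear p a u v : tangent p u -> tangent p v ->
  Vproj gM F p (a *: u + v) = a *: Vproj gM F p u + Vproj gM F p v.
Proof.
move=> tu tv; have vu := vertical_Vproj gMP subF tu.
have vv := vertical_Vproj gMP subF tv.
apply: (Vproj_eq gMP); first exact: vertical_linear.
have -> : a *: u + v - (a *: Vproj gM F p u + Vproj gM F p v) =
    a *: Hproj gM F p u + Hproj gM F p v.
  by apply/funext => f; rewrite /Hproj !(vecDE, vecNE, vecZE); ring.
by apply: (horizontal_linear gMP); exact: (horizontal_Hproj gMP subF).
Qed.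

Lemma psiD p u v : tangent p u -> tangent p v -> psiF p (u + v) = psiF p u + psiF p v.
Proof.
move=> tu tv; rewrite /psiF /psi.
rewrite (linear_onD (@ac_phi_linear _ _ _ _ _ _ _ acM p)) //.
have := Vproj_linear 1 (tphi tu) (tphi tv).
by rewrite !scale1r.
Qed.

Lemma psi_multiple p a : psiF p (a *: xi p) = 0.
Proof.
rewrite /psiF /psi (linear_onZ (@ac_phi_linear _ _ _ _ _ _ _ acM p)) //.
by rewrite (ac_phi_xi acM) scaler0 (Vproj_vertical gMP) //; exact: (vertical0 F p).
Qed.

Lemma phi_norm_gt0 p u : tangent p u -> (forall a, u <> a *: xi p) ->
  0 < gM p (phi p u) (phi p u).
Proof.
move=> tu nu; apply: (Defs.metric_pos gMP (tphi tu)) => phiu0.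
have := ac_phi2 acM tu.
rewrite phiu0 (linear_on0 (@ac_phi_linear _ _ _ _ _ _ _ acM p)).
by move=> /esym/eqP; rewrite addrC subr_eq0 => /eqP/esym; exact: nu.
Qed.

Lemma psi_norm_le p u : tangent p u ->
  gM p (psiF p u) (psiF p u) <= gM p (phi p u) (phi p u).
Proof.
move=> tu; have tphiu := tphi tu.
have vu := vertical_Vproj gMP subF tphiu.
have hu := horizontal_Hproj gMP subF tphiu.
rewrite /psiF /psi -{3 4}(VHprojK gM F p (phi p u)).
move: (Vproj _ _ _ _) (Hproj _ _ _ _) vu hu => v w vv hw.
have tv := vv.1; have tw := hw.1.
rewrite !(metricDl gMP, metricDr gMP) //; try exact: tangent_add.
rewrite (metric_vert_hor gMP vv hw) hw.2 // addr0 add0r lerDl.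
exact: (metric_ge0 gMP).
Qed.

(** The squared cosine of the angle between phi u and ker F_*; the denominator vanishes when u is a
    multiple of xi, so these vectors are treated apart. *)
Let ratio p u := gM p (psiF p u) (psiF p u) / gM p (phi p u) (phi p u).

Lemma slant_ratio p u : vertical F p u -> (forall a, u <> a *: xi p) ->
  0 <= ratio p u <= 1 /\ theta = acos (Num.sqrt (ratio p u)).
Proof.
move=> vu nu; have tu := vu.1; have phi0 := phi_norm_gt0 tu nu.
have psi0 : 0 <= gM p (psiF p u) (psiF p u).
  by apply: (metric_ge0 gMP); apply: (vertical_Vproj gMP subF (tphi tu)).1.
split.
  rewrite divr_ge0 ?(ltW phi0) //=.
  by rewrite ler_pdivrMr // mul1r psi_norm_le.
rewrite -(slantF vu nu) /angle_to_vertical /gnorm /ratio sqrtrM //.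
by rewrite sqrtrV // ltW.
Qed.

(* If every vertical vector is a multiple of xi, then psi = 0 and any constant
   will do. *)
Lemma slant_constant : exists2 c : R, c != 1 & forall p u, vertical F p u ->
  gM p (psiF p u) (psiF p u) = c * (gM p u u - eta p u ^+ 2).
Proof.
have mult c p a : gM p (psiF p (a *: xi p)) (psiF p (a *: xi p)) =
    c * (gM p (a *: xi p) (a *: xi p) - eta p (a *: xi p) ^+ 2).
  rewrite psi_multiple (metric0l gMP); last exact: tangent0.
  rewrite !(metricZl gMP, metricZr gMP) //; last exact: tangent_scale.
  rewrite (linear_onZ (ac_eta_linear acM (p := p))) // -(ac_eta_g acM) //.
  by rewrite (ac_eta_xi acM) /GRing.scale /=; ring.
have [[p0 [u0 [vu0 nu0]]]|none] :=
    pselect (exists p u, vertical F p u /\ forall a, u <> a *: xi p); last first.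
  exists 0; first by rewrite eq_sym oner_eq0.
  move=> p u vu; have [[a ->]|nu] := pselect (exists a, u = a *: xi p).
    exact: mult.
  by case: none; exists p, u; split=> // a ua; apply: nu; exists a.
have [/andP[r0 r1] th] := slant_ratio vu0 nu0.
have cosK_sqrt (r : R) : 0 <= r -> r <= 1 -> cos (acos (Num.sqrt r)) = Num.sqrt r.
  move=> r_ge0 r_le1; apply: acosK.
  rewrite in_itv /= (le_trans _ (sqrtr_ge0 _)) ?lerN10 //=.
  by rewrite -sqrtr1 ler_wsqrtr.
(* The constant is cos^2 theta, read off at one vector. If it were 1, theta would be acos 1 = 0. *)
exists (ratio p0 u0).
  by apply/eqP => r_eq1; apply: theta_neq0; rewrite th r_eq1 sqrtr1 acos1.
move=> p u vu; have [[a ->]|nu] := pselect (exists a, u = a *: xi p).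
  exact: mult.
have {}nu a : u <> a *: xi p by move=> ua; apply: nu; exists a.
have [/andP[s0 s1] th'] := slant_ratio vu nu.
(* Both ratios lie in [0, 1], where the square root followed by [acos] is injective. *)
have rs : ratio p u = ratio p0 u0.
  rewrite -[LHS]sqr_sqrtr // -[RHS]sqr_sqrtr //; congr (_ ^+ 2).
  by rewrite -(cosK_sqrt _ s0 s1) -th' th cosK_sqrt.
have tu := vu.1; rewrite expr2 -(ac_compat acM) // -rs /ratio divfK //.
by rewrite gt_eqF // phi_norm_gt0.
Qed.

(** Polarizing [slant_constant] gives g(psi u, psi v) = c (g(u, v) - eta(u) eta(v)), and psi is skew
    on vertical vectors. Hence c (u - eta(u) xi) + psi^2 u is orthogonal to every vertical vector;
    being vertical, it is 0. *)
Lemma slant_psi2 : exists2 c : R, c != 1 & forall p u, vertical F p u ->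
  psiF p (psiF p u) = - c *: (u - eta p u *: xi p).
Proof.
have [c c1 cP] := slant_constant; exists c => // p u vu.
have vpsi v : tangent p v -> vertical F p (psiF p v).
  by move=> tv; exact: (vertical_Vproj gMP subF (tphi tv)).
have polar v : vertical F p v ->
    gM p (psiF p u) (psiF p v) = c * (gM p u v - eta p u * eta p v).
  move=> vv; have vuv := vertical_linear 1 vu vv.
  have := cP p _ vuv; have := cP p u vu; have := cP p v vv.
  move: vu.1 vv.1 => tu tv; rewrite scale1r psiD //.
  have tpu := (vpsi _ tu).1; have tpv := (vpsi _ tv).1.
  rewrite (linear_onD (ac_eta_linear acM (p := p))) //.
  rewrite !(metricDl gMP, metricDr gMP) //; try exact: tangent_add.
  rewrite (Defs.metric_sym gMP tpv tpu) (Defs.metric_sym gMP tv tu).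
  rewrite !expr2 => e1 e2 e3; lra.
have tu := vu.1; have vpu := vpsi _ tu; have tpu := vpu.1.
have vxi := xi_vert p.
have vw : vertical F p (u - eta p u *: xi p).
  by have := vertical_linear (- eta p u) vxi vu; rewrite scaleNr addrC.
have vd : vertical F p (c *: (u - eta p u *: xi p) + psiF p (psiF p u)).
  by apply: vertical_linear => //; exact: vpsi.
suff d0 : c *: (u - eta p u *: xi p) + psiF p (psiF p u) = 0.
  by move/eqP: d0; rewrite addrC addr_eq0 scaleNr => /eqP.
apply: (metric_eq0 gMP vd.1).
have test v : vertical F p v ->
    gM p (c *: (u - eta p u *: xi p) + psiF p (psiF p u)) v = 0.
  move=> vv; have tv := vv.1; have tw := vw.1; have tpv := (vpsi _ tv).1.
  rewrite (metricDl gMP) ?(metricZl gMP) //; last 2 first.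
  - exact: tangent_scale.
  - exact: (vpsi _ tpu).1.
  rewrite (metricBl gMP) ?(metricZl gMP) //; last exact: tangent_scale.
  rewrite {2}/psiF /psi (metric_Vproj gMP subF (tphi tpu) vv).
  rewrite (phi_skew acM) // (Defs.metric_sym gMP tpu (tphi tv)).
  rewrite -(metric_Vproj gMP subF (tphi tv) vpu).
  rewrite (Defs.metric_sym gMP tpv tpu) polar //.
  rewrite (Defs.metric_sym gMP (txi p) tv) -(ac_eta_g acM tv); ring.
exact: test.
Qed.

End SlantSubmersion.

(** * Covariant derivatives of vertical fields *)

Section KeyIdentity.
Context {R : realType} {m n : nat} {M : @manifold R m} {N : @manifold R n}.
Variables (phi : M -> vec M -> vec M) (xi : M -> vec M) (eta : M -> vec M -> R)
  (g : M -> vec M -> vec M -> R) (gN : N -> vec N -> vec N -> R)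
  (nabla : M -> vec M -> (M -> vec M) -> vec M) (F : M -> N) (c : R).
Hypotheses (cosM : cosymplectic phi xi eta g) (lcM : levi_civita g nabla)
  (subF : riemannian_submersion g gN F)
  (xi_vert : forall p, vertical F p (xi p))
  (psi2 : forall p u, vertical F p u ->
    psi g F phi p (psi g F phi p u) = - c *: (u - eta p u *: xi p)).
Implicit Types (E V X : M -> vec M).

Let acM : almost_contact_metric phi xi eta g := cos_acm cosM.
Let gP : riemannian_metric g := ac_metric acM.
Let conM : connection_along idfun nabla := lc_conn lcM.
Let psiV V q := psi g F phi q (V q).
Let omegaV V q := omega g F phi q (V q).

Lemma field_phi V : vector_field V -> vector_field (fun q => phi q (V q)).
Proof. by move=> vV p; exact: (ac_phi_smooth acM (vV p)). Qed.

Lemma field_psi V : vector_field V -> vector_field (psiV V).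
Proof. by move=> vV p; exact: (field_Vproj gP subF (field_phi vV p)). Qed.

Lemma field_omega V : vector_field V -> vector_field (omegaV V).
Proof. by move=> vV p; exact: (field_Hproj gP subF (field_phi vV p)). Qed.

Lemma nabla_phi_split E V p : vector_field E -> vector_field V ->
  phi p (nabla p (E p) V) = nabla p (E p) (psiV V) + nabla p (E p) (omegaV V).
Proof.
move=> vE vV; rewrite -(nabla_phi cosM lcM p vE vV).
have tE := field_along_tangent (vE p).
rewrite -(conn_additive conM tE (field_psi vV p) (field_omega vV p)).
congr (nabla p (E p)); apply/funext => q.
by rewrite /psiV /omegaV /psi /omega VHprojK.
Qed.

(** [E] is left arbitrary, so that one identity serves both conditions, with E vertical and with E
    horizontal. *)
Lemma nabla_vertical E V X p : vector_field E -> vertical_field F V ->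
  horizontal g F p (X p) ->
  (1 - c) * g p (nabla p (E p) V) (X p) =
  - g p (Hproj g F p (nabla p (E p) (omegaV (psiV V)))) (X p)
  + (g p (Vproj g F p (nabla p (E p) (omegaV V))) (Bpart g F phi p (X p))
     + g p (Hproj g F p (nabla p (E p) (omegaV V))) (Cpart g F phi p (X p))).
Proof.
move=> vE [vV V0] hX; have tE := field_along_tangent (vE p); have tX := hX.1.
have vpsi := field_psi vV; have vomega := field_omega vV.
have vpsi2 := field_psi vpsi; have vomegapsi := field_omega vpsi.
have tn W : vector_field W -> tangent p (nabla p (E p) W).
  by move=> vW; exact: (conn_tangent conM tE (vW p)).
have txi := (xi_vert p).1.
have tphiX := tangent_phi acM tX.
have etaX : eta p (X p) = 0.
  by rewrite (ac_eta_g acM tX) (Defs.metric_sym gP tX txi) (metric_vert_hor gP (xi_vert p) hX).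
have nV : g p (nabla p (E p) V) (X p) =
    g p (nabla p (E p) (psiV V)) (phi p (X p)) +
    g p (nabla p (E p) (omegaV V)) (phi p (X p)).
  rewrite -(metricDl gP) //; try exact: tn.
  rewrite -nabla_phi_split // (ac_compat acM) //; last exact: tn.
  by rewrite etaX mulr0 subr0.
have npsi : g p (nabla p (E p) (psiV V)) (phi p (X p)) =
    - g p (nabla p (E p) (psiV (psiV V))) (X p)
    - g p (nabla p (E p) (omegaV (psiV V))) (X p).
  rewrite -[LHS]opprK -(phi_skew acM) //; last exact: tn.
  rewrite nabla_phi_split // (metricDl gP) ?opprD //; exact: tn.
(* Since xi is parallel, eta(V) xi has a derivative proportional to xi, hence orthogonal to X. The
   remaining multiple of g(nabla_E V, X) is what turns the factor 1 on the left into 1 - c. *)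
have npsi2 : g p (nabla p (E p) (psiV (psiV V))) (X p) =
    - c * g p (nabla p (E p) V) (X p).
  have fxi := ac_xi acM p.
  have sV := ac_eta_smooth acM (vV p).
  have fVxi : field_at p (fun q => V q - eta q (V q) *: xi q).
    exact: (field_alongB (vV p) (field_alongZ sV fxi)).
  have -> : psiV (psiV V) = (fun q => - c *: (V q - eta q (V q) *: xi q)).
    by apply/funext => q; rewrite /psiV psi2.
  rewrite (conn_leibniz conM tE (smooth_fun_at_cst (- c)) fVxi).
  rewrite (tangent_cst _ tE) scale0r add0r.
  rewrite (connB conM tE (vV p) (field_alongZ sV fxi)).
  rewrite (conn_leibniz conM tE sV fxi) (nabla_xi cosM lcM p vE) scaler0 addr0.
  have ts := tangent_scale (E p (fun q => eta q (V q))) txi.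
  rewrite (metricZl gP) //; last by apply: tangent_sub => //; exact: tn.
  rewrite (metricBl gP) ?(metricZl gP) //; last exact: tn.
  by rewrite (metric_vert_hor gP (xi_vert p) hX) mulr0 subr0.
have nomega : g p (nabla p (E p) (omegaV V)) (phi p (X p)) =
    g p (Vproj g F p (nabla p (E p) (omegaV V))) (Bpart g F phi p (X p)) +
    g p (Hproj g F p (nabla p (E p) (omegaV V))) (Cpart g F phi p (X p)).
  have vB := vertical_Vproj gP subF tphiX; have hC := horizontal_Hproj gP subF tphiX.
  rewrite (metric_Vproj gP subF (tn _ vomega) vB).
  rewrite (metric_Hproj gP subF (tn _ vomega) hC).
  rewrite /Bpart /Cpart -(metricDr gP vB.1 hC.1) ?VHprojK //.
  exact: tn.
rewrite (metric_Hproj gP subF (tn _ vomegapsi) hX) -nomega.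
rewrite npsi npsi2 in nV; lra.
Qed.

Lemma Vproj_omega V : vector_field V ->
  (fun q => Vproj g F q (omegaV V q)) = fun=> 0.
Proof.
move=> vV; apply/funext => q; apply: (Vproj_horizontal gP).
exact: (horizontal_Hproj gP subF (field_along_tangent (field_phi vV q))).
Qed.

Lemma Hproj_omega V : vector_field V ->
  (fun q => Hproj g F q (omegaV V q)) = omegaV V.
Proof.
move=> vV; apply/funext => q; apply: (Hproj_horizontal gP).
exact: (horizontal_Hproj gP subF (field_along_tangent (field_phi vV q))).
Qed.

(** As omega V is horizontal, the first summand of T differentiates the zero field; in
    [oneill_A_omega] it is the second summand of A that does. *)
Lemma oneill_T_omega U V p : vertical_field F U -> vector_field V ->
  oneill_T g F nabla U (omegaV V) p = Vproj g F p (nabla p (U p) (omegaV V)).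
Proof.
move=> [vU U0] vV; rewrite /oneill_T Vproj_omega // Hproj_omega //.
rewrite (Vproj_vertical gP (U0 p)) (conn0 conM (field_along_tangent (vU p))).
by rewrite (Hproj_vertical gP (vertical0 F p)) add0r.
Qed.

Lemma oneill_A_omega Z V p : horizontal_field g F Z -> vector_field V ->
  oneill_A g F nabla Z (omegaV V) p = Vproj g F p (nabla p (Z p) (omegaV V)).
Proof.
move=> [vZ Z0] vV; rewrite /oneill_A Vproj_omega // Hproj_omega //.
rewrite (Hproj_horizontal gP (Z0 p)) (conn0 conM (field_along_tangent (vZ p))).
by rewrite (Hproj_vertical gP (vertical0 F p)) addr0.
Qed.

End KeyIdentity.

Theorem theorem7 (R : realType) (m n : nat)
  (M : @manifold R m) (N : @manifold R n)
  (phi : M -> vec M -> vec M) (xi : M -> vec M) (eta : M -> vec M -> R)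
  (gM : M -> vec M -> vec M -> R) (gN : N -> vec N -> vec N -> R)
  (nablaM : M -> vec M -> (M -> vec M) -> vec M)
  (nablaN : N -> vec N -> (N -> vec N) -> vec N)
  (F : M -> N)
  (nablaF : M -> vec M -> (M -> vec N) -> vec N)
  (theta : R) :
  cosymplectic phi xi eta gM ->
  riemannian_metric gN ->
  levi_civita gM nablaM ->
  levi_civita gN nablaN ->
  riemannian_submersion gM gN F ->
  pullback_connection F nablaN nablaF ->
  slant gM F phi xi theta ->
  theta <> 0 ->
  (forall p, vertical F p (xi p)) ->
  (totally_geodesic F nablaM nablaF <->
   forall U V X Z : M -> vec M,
     vertical_field F U -> vertical_field F V ->
     horizontal_field gM F X -> horizontal_field gM F Z ->
     forall p : M,
     let H := Hproj gM F in
     let psi := psi gM F phi in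
     let omega := omega gM F phi in
     let B := Bpart gM F phi in
     let C := Cpart gM F phi in
     let T := oneill_T gM F nablaM in
     let A := oneill_A gM F nablaM in
     gM p (H p (nablaM p (U p) (fun q => omega q (psi q (V q))))) (X p)
       = gM p (T U (fun q => omega q (V q)) p) (B p (X p))
         + gM p (H p (nablaM p (U p) (fun q => omega q (V q)))) (C p (X p))
     /\
     gM p (H p (nablaM p (Z p) (fun q => omega q (psi q (U q))))) (X p)
       = gM p (A Z (fun q => omega q (U q)) p) (B p (X p))
         + gM p (H p (nablaM p (Z p) (fun q => omega q (U q)))) (C p (X p))).

Proof.
move=> cosM gNP lcM lcN subF pcF slantF theta0 xiV.
have gMP := ac_metric (cos_acm cosM).
have [c c1 psi2] := slant_psi2 (cos_acm cosM) subF slantF theta0 xiV.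
have c1' : 1 - c != 0 by rewrite subr_eq0 eq_sym.
apply: (iff_trans (totally_geodesicP gMP gNP lcM lcN subF pcF)).
split=> H U V X Z vU vV hX hZ p.
- move=> Hp psi' omega' B C T A; have [e1 e2] := H U V X Z vU vV hX hZ p.
  have k1 := nabla_vertical cosM lcM subF xiV psi2 vU.1 vV (hX.2 p).
  have k2 := nabla_vertical cosM lcM subF xiV psi2 hZ.1 vU (hX.2 p).
  rewrite /T /A (oneill_T_omega cosM lcM subF p vU vV.1).
  rewrite (oneill_A_omega cosM lcM subF p hZ vU.1).
  move: k1 k2; rewrite e1 e2 !mulr0 => k1 k2.
  by split; apply/esym/eqP; rewrite -subr_eq0 addrC; apply/eqP.
- have [e1 e2] := H U V X Z vU vV hX hZ p; move: e1 e2.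
  rewrite (oneill_T_omega cosM lcM subF p vU vV.1).
  rewrite (oneill_A_omega cosM lcM subF p hZ vU.1) => e1 e2.
  split; apply: (mulfI c1'); rewrite mulr0.
    by rewrite (nabla_vertical cosM lcM subF xiV psi2 vU.1 vV (hX.2 p)) -e1 addNr.
  by rewrite (nabla_vertical cosM lcM subF xiV psi2 hZ.1 vU (hX.2 p)) -e2 addNr.
Qed.
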